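(* The validity problem of $\mathrm{FOT}(\to)$ is equivalent to the validity problem of second-order logic: each is reducible to the other by a computable (many-one) reduction, i.e. there is a computable map sending each $\mathrm{FOT}(\to)$-formula $\varphi$ to a second-order sentence that is valid if and only if $\varphi$ is valid, and a computable map sending each second-order sentence $\Phi$ to an $\mathrm{FOT}(\to)$-formula that is valid if and only if $\Phi$ is valid.
   Context: Second-order logic is taken with full (standard) semantics; a second-order sentence is valid if it is true in every structure. An $\mathrm{FOT}(\to)$-formula is valid if it is satisfied by every team (with domain containing its free variables) over every model. Structures $M$ have nonempty domain; the same letter denotes a structure and its domain. An assignment over $M$ is a map from a finite set of variables to $M$. A team over $M$ is a set of assignments with a common domain; the empty team is allowed. $s(a/x)$ is the assignment mapping $x$ to $a$ and otherwise agreeing with $s$; $X(a/x)=\{s(a/x):s\in X\}$. Formulas of $\mathrm{FOT}(\to)$: $\varphi::=\lambda\mid\bar x\neq\bar y\mid\dot\sim\varphi\mid(\varphi\land\varphi)\mid(\varphi\vee_w\varphi)\mid\exists^1x\,\varphi\mid\forall^1x\,\varphi\mid(\varphi\to\varphi)$, where $\lambda$ is a first-order atomic formula (including equality) and $\bar x,\bar y$ are tuples of variables of equal length. Satisfaction $M,X\models\varphi$ (the domain of $X$ contains the free variables of $\varphi$): - $M,X\models\lambda$ iff every $s\in X$ satisfies $\lambda$ in $M$ in the usual first-order sense; - $M,X\models\bar x\neq\bar y$ iff $s(\bar x)\neq s(\bar y)$ for all $s\in X$; - $M,X\models\dot\sim\varphi$ iff $X=\emptyset$ or $M,X\not\models\varphi$;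 - $M,X\models\varphi\land\psi$ iff $M,X\models\varphi$ and $M,X\models\psi$; - $M,X\models\varphi\vee_w\psi$ iff $M,X\models\varphi$ or $M,X\models\psi$; - $M,X\models\exists^1x\,\varphi$ iff $M,X(a/x)\models\varphi$ for some $a\in M$; - $M,X\models\forall^1x\,\varphi$ iff $M,X(a/x)\models\varphi$ for all $a\in M$; - $M,X\models\varphi\to\psi$ iff for every $Y\subseteq X$, if $M,Y\models\varphi$ then $M,Y\models\psi$. *)

(* Defs.v *)
From mathcomp Require Import all_boot finmap.
From mathcomp Require Import boolp classical_sets.
From Stdlib Require Relation_Operators.

Set Implicit Arguments.
Unset Strict Implicit.
Unset Printing Implicit Defensive.

Local Open Scope classical_set_scope.
Local Open Scope fmap_scope.

(** * First-order vocabulary, structures, assignments *)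

Definition var := nat.

(* The vocabulary has countably many function and relation symbols of every
   arity.  A symbol is a pair of an index [i] and an arity [n]; the arity is not
   stored but read off the number of arguments: [Fun i ts] is the function
   symbol (i, size ts) applied to [ts] (constants are the case [ts = [::]]),
   and [Rel i ts] is the relation symbol (i, size ts) applied to [ts]. *)
Inductive term := Var (x : var) | Fun (i : nat) (ts : seq term).

Inductive atom := Eq (t u : term) | Rel (i : nat) (ts : seq term).

(* A function on [seq dom] is the same thing as a family of n-ary functions on
   [dom], one for each n; so [funI i] interprets all symbols (i, n), and
   likewise [relI i]. *)
Record structure : Type := Structure {
  dom :> Type;
  dom_nonempty : inhabited dom;
  funI : nat -> seq dom -> dom;
  relI : nat -> seq dom -> Prop }.

Definition assignment (M : structure) := {fmap var -> dom M}.

Definition oseq (T : Type) : seq (option T) -> option (seq T) :=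
  foldr (fun o os => obind (fun a => omap (cons a) os) o) (Some [::]).

(* [None] when some variable of the term is outside the domain of [s]. *)
Fixpoint eval (M : structure) (s : assignment M) (t : term) : option M :=
  match t with
  | Var x => s.[? x]
  | Fun i ts => omap (funI i) (oseq (map (eval s) ts))
  end.

Definition evals (M : structure) (s : assignment M) (ts : seq term) :
  option (seq M) := oseq (map (eval s) ts).

Definition atom_sat (M : structure) (s : assignment M) (l : atom) : Prop :=
  match l with
  | Eq t u => exists2 a, eval s t = Some a & eval s u = Some a
  | Rel i ts => exists2 v, evals s ts = Some v & relI i v
  end.

Fixpoint term_vars (t : term) : seq var :=
  match t with
  | Var x => [:: x]
  | Fun _ ts => flatten (map term_vars ts)
  end.

Definition terms_vars (ts : seq term) : seq var := flatten (map term_vars ts).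

Definition atom_vars (l : atom) : seq var :=
  match l with
  | Eq t u => term_vars t ++ term_vars u
  | Rel _ ts => terms_vars ts
  end.

(** * The logic FOT(->) *)

(* The two tuples of an inequality atom, being of equal length, are given as
   the sequence of pairs [(x_1, y_1); ...; (x_n, y_n)]. *)
Inductive fot :=
  | FAtom (l : atom)
  | FNeq (xys : seq (var * var))
  | FNot (phi : fot)
  | FAnd (phi psi : fot)
  | FOr (phi psi : fot)
  | FEx (x : var) (phi : fot)
  | FAll (x : var) (phi : fot)
  | FImp (phi psi : fot).

Fixpoint fot_fv (phi : fot) : seq var :=
  match phi with
  | FAtom l => atom_vars l
  | FNeq xys => unzip1 xys ++ unzip2 xys
  | FNot phi => fot_fv phi
  | FAnd phi psi | FOr phi psi | FImp phi psi => fot_fv phi ++ fot_fv psi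
  | FEx x phi | FAll x phi => [seq y <- fot_fv phi | y != x]
  end.

(* The empty set is a team with every domain. *)
Definition team_on (M : structure) (D : {fset var}) (X : set (assignment M)) :=
  forall s, X s -> domf s = D.

Definition team_upd (M : structure) (X : set (assignment M)) (x : var) (a : M) :
  set (assignment M) := [set s.[x <- a] | s in X].

Fixpoint fot_sat (M : structure) (X : set (assignment M)) (phi : fot) : Prop :=
  match phi with
  | FAtom l => forall s, X s -> atom_sat s l
  | FNeq xys => forall s, X s ->
      [seq s.[? x] | x <- unzip1 xys] <> [seq s.[? y] | y <- unzip2 xys]
  | FNot phi => X = set0 \/ ~ fot_sat X phi
  | FAnd phi psi => fot_sat X phi /\ fot_sat X psi
  | FOr phi psi => fot_sat X phi \/ fot_sat X psi
  | FEx x phi => exists a : M, fot_sat (team_upd X x a) phi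
  | FAll x phi => forall a : M, fot_sat (team_upd X x a) phi
  | FImp phi psi => forall Y, Y `<=` X -> fot_sat Y phi -> fot_sat Y psi
  end.

Definition fot_valid (phi : fot) : Prop :=
  forall (M : structure) (D : {fset var}) (X : set (assignment M)),
    {subset fot_fv phi <= D} -> team_on D X -> fot_sat X phi.

(** * Second-order logic with full semantics *)

(* As for symbols, a relation variable is a pair of an index and an arity;
   [SRel i ts] is the relation variable (i, size ts) applied to [ts], and
   [SEx2 i n], [SAll2 i n] bind the relation variable (i, n) only. *)
Inductive so :=
  | SAtom (l : atom)
  | SRel (i : nat) (ts : seq term)
  | SNot (phi : so)
  | SAnd (phi psi : so)
  | SOr (phi psi : so)
  | SEx (x : var) (phi : so)
  | SAll (x : var) (phi : so)
  | SEx2 (i n : nat) (phi : so)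
  | SAll2 (i n : nat) (phi : so).

Fixpoint so_fv (phi : so) : seq var :=
  match phi with
  | SAtom l => atom_vars l
  | SRel _ ts => terms_vars ts
  | SNot phi | SEx2 _ _ phi | SAll2 _ _ phi => so_fv phi
  | SAnd phi psi | SOr phi psi => so_fv phi ++ so_fv psi
  | SEx x phi | SAll x phi => [seq y <- so_fv phi | y != x]
  end.

Fixpoint so_frv (phi : so) : seq (nat * nat) :=
  match phi with
  | SAtom _ => [::]
  | SRel i ts => [:: (i, size ts)]
  | SNot phi | SEx _ phi | SAll _ phi => so_frv phi
  | SAnd phi psi | SOr phi psi => so_frv phi ++ so_frv psi
  | SEx2 i n phi | SAll2 i n phi => [seq v <- so_frv phi | v != (i, n)]
  end.

Definition closed_so (phi : so) : bool := nilp (so_fv phi) && nilp (so_frv phi).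

Definition so_sentence := {phi : so | closed_so phi}.

Definition rel_assignment (M : structure) := nat -> seq M -> Prop.

(* Only the values of [P] on sequences of length [n] matter. *)
Definition rel_upd (M : structure) (r : rel_assignment M) (i n : nat)
    (P : seq M -> Prop) : rel_assignment M :=
  fun j v => if (j, size v) == (i, n) then P v else r j v.

Fixpoint so_sat (M : structure) (s : assignment M) (r : rel_assignment M)
    (phi : so) : Prop :=
  match phi with
  | SAtom l => atom_sat s l
  | SRel i ts => exists2 v, evals s ts = Some v & r i v
  | SNot phi => ~ so_sat s r phi
  | SAnd phi psi => so_sat s r phi /\ so_sat s r psi
  | SOr phi psi => so_sat s r phi \/ so_sat s r psi
  | SEx x phi => exists a : M, so_sat s.[x <- a] r phi
  | SAll x phi => forall a : M, so_sat s.[x <- a] r phi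
  | SEx2 i n phi => exists P : seq M -> Prop, so_sat s (rel_upd r i n P) phi
  | SAll2 i n phi => forall P : seq M -> Prop, so_sat s (rel_upd r i n P) phi
  end.

Definition so_valid (Phi : so_sentence) : Prop :=
  forall (M : structure) (s : assignment M) (r : rel_assignment M),
    so_sat s r (val Phi).

(** * Computable maps: lambda-definability *)

(* Untyped lambda-terms with de Bruijn indices. *)
Inductive lterm := LVar (n : nat) | LApp (t u : lterm) | LLam (t : lterm).

Fixpoint lift (k : nat) (t : lterm) : lterm :=
  match t with
  | LVar n => LVar (if n < k then n else n.+1)
  | LApp t u => LApp (lift k t) (lift k u)
  | LLam t => LLam (lift k.+1 t)
  end.

(* Replaces index [k] by [u] and decrements the indices above [k]. *)
Fixpoint lsubst (k : nat) (u t : lterm) : lterm :=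
  match t with
  | LVar n => if n < k then LVar n else if n == k then u else LVar n.-1
  | LApp t1 t2 => LApp (lsubst k u t1) (lsubst k u t2)
  | LLam t => LLam (lsubst k.+1 (lift 0 u) t)
  end.

Inductive beta : lterm -> lterm -> Prop :=
  | Beta t u : beta (LApp (LLam t) u) (lsubst 0 u t)
  | BetaAppL t t' u : beta t t' -> beta (LApp t u) (LApp t' u)
  | BetaAppR t u u' : beta u u' -> beta (LApp t u) (LApp t u')
  | BetaLam t t' : beta t t' -> beta (LLam t) (LLam t').

Definition beta_star : lterm -> lterm -> Prop :=
  Relation_Operators.clos_refl_trans lterm beta.

Fixpoint lclosed_at (k : nat) (t : lterm) : bool :=
  match t with
  | LVar n => n < k
  | LApp t u => lclosed_at k t && lclosed_at k u
  | LLam t => lclosed_at k.+1 t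
  end.

Definition lclosed : pred lterm := lclosed_at 0.

Definition computable (A B : Type) (codeA : A -> lterm) (codeB : B -> lterm)
    (f : A -> B) : Prop :=
  exists2 p : lterm, lclosed p &
    forall a : A, beta_star (LApp p (codeA a)) (codeB (f a)).

(* Scott encoding: the i-th (from 0) of the k constructors of a data type,
   applied to closed codes c_1, ..., c_m, is the normal form
   \b_0 ... b_(k-1), b_i c_1 ... c_m. *)
Definition scott (k i : nat) (cs : seq lterm) : lterm :=
  iter k LLam (foldl LApp (LVar (k - i.+1)) cs).

Fixpoint code_nat (n : nat) : lterm :=
  match n with
  | 0 => scott 2 0 [::]
  | n.+1 => scott 2 1 [:: code_nat n]
  end.

Definition code_seq (T : Type) (code : T -> lterm) : seq T -> lterm :=
  foldr (fun x c => scott 2 1 [:: code x; c]) (scott 2 0 [::]).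

Definition code_pair (p : nat * nat) : lterm :=
  scott 1 0 [:: code_nat p.1; code_nat p.2].

Fixpoint code_term (t : term) : lterm :=
  match t with
  | Var x => scott 2 0 [:: code_nat x]
  | Fun i ts => scott 2 1 [:: code_nat i; code_seq code_term ts]
  end.

Definition code_atom (l : atom) : lterm :=
  match l with
  | Eq t u => scott 2 0 [:: code_term t; code_term u]
  | Rel i ts => scott 2 1 [:: code_nat i; code_seq code_term ts]
  end.

Fixpoint code_fot (phi : fot) : lterm :=
  match phi with
  | FAtom l => scott 8 0 [:: code_atom l]
  | FNeq xys => scott 8 1 [:: code_seq code_pair xys]
  | FNot phi => scott 8 2 [:: code_fot phi]
  | FAnd phi psi => scott 8 3 [:: code_fot phi; code_fot psi]
  | FOr phi psi => scott 8 4 [:: code_fot phi; code_fot psi]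
  | FEx x phi => scott 8 5 [:: code_nat x; code_fot phi]
  | FAll x phi => scott 8 6 [:: code_nat x; code_fot phi]
  | FImp phi psi => scott 8 7 [:: code_fot phi; code_fot psi]
  end.

Fixpoint code_so (phi : so) : lterm :=
  match phi with
  | SAtom l => scott 9 0 [:: code_atom l]
  | SRel i ts => scott 9 1 [:: code_nat i; code_seq code_term ts]
  | SNot phi => scott 9 2 [:: code_so phi]
  | SAnd phi psi => scott 9 3 [:: code_so phi; code_so psi]
  | SOr phi psi => scott 9 4 [:: code_so phi; code_so psi]
  | SEx x phi => scott 9 5 [:: code_nat x; code_so phi]
  | SAll x phi => scott 9 6 [:: code_nat x; code_so phi]
  | SEx2 i n phi => scott 9 7 [:: code_nat i; code_nat n; code_so phi]
  | SAll2 i n phi => scott 9 8 [:: code_nat i; code_nat n; code_so phi]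
  end.

Definition code_sentence (Phi : so_sentence) : lterm := code_so (val Phi).

(* Main.v *)
Require Import Defs.
From mathcomp Require Import all_boot finmap.
From mathcomp Require Import boolp classical_sets.
From mathcomp Require Import zify.
From Stdlib Require Relation_Operators.

(* From FOT to second-order logic, a team over the variables 0, ..., N-1 is an
   N-ary relation, and every clause of the team semantics is second-order
   definable; as satisfaction only depends on the free variables, such teams
   suffice.

   Conversely, a structure M can be replaced by an infinite structure K with a
   pairing function in which M is the range of a unary function p, since the
   axioms saying so can be put into the formula.  A team over K is used only
   through the set of values of one variable, initially all of K.  The relation
   quantified at nesting depth d is stored in this set at the keys of level d:
   a key whose two bits (two distinct codes attached to the key) were both
   present keeps exactly one, its truth value.  Implication quantifies over
   the subteams, and a first-order condition selects those in which every key
   has a bit left, the keys of level d have exactly one, and deeper keys have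
   both.  Such a subteam chooses a new relation and cannot change the older
   ones, which have no bit to spare.

   Computability is obtained from a logical relation between closed
   lambda-terms and Gallina functions: a realizer of a translation is found by
   recursion on its Gallina text. *)

Set Implicit Arguments.
Unset Strict Implicit.
Unset Printing Implicit Defensive.

(** A subteam can only lose assignments, never record new data. If a relation were stored as the
    bare presence of its tuples, a later quantifier could delete tuples of an earlier relation; two
    complementary bits per key, one of which must survive, rule this out. The team can be read at
    all because a negated inequality atom says that some assignment takes a given value. A finite
    structure with more than one element has no injective pairing, so M itself cannot supply the
    keys in general. As p is a map onto M and not a predicate, quantifiers over K act as quantifiers
    over M without being relativized. Both directions of the correctness proof share one
    interpretation of M in K: from M, K is built as the binary trees over M; from K, M is obtained
    as the range of p. Every formula holds in the empty team, so negation is classical only in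
    nonempty teams, and nonemptiness is part of the invariant. *)

(** * Reduction and simultaneous substitution of closed terms *)

Lemma beta_star_refl t : beta_star t t.
Proof. exact: Relation_Operators.rt_refl. Qed.

Lemma beta_star_trans u t v : beta_star t u -> beta_star u v -> beta_star t v.
Proof. exact: Relation_Operators.rt_trans. Qed.

Lemma beta_star_appl t t' u : beta_star t t' -> beta_star (LApp t u) (LApp t' u).
Proof.
elim=> [v w b|v|v w x _ IH1 _ IH2]; last exact: beta_star_trans IH1 IH2.
- by apply: Relation_Operators.rt_step; apply: BetaAppL.
- exact: beta_star_refl.
Qed.

Lemma beta_star_appr t u u' : beta_star u u' -> beta_star (LApp t u) (LApp t u').
Proof.
elim=> [v w b|v|v w x _ IH1 _ IH2]; last exact: beta_star_trans IH1 IH2.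
- by apply: Relation_Operators.rt_step; apply: BetaAppR.
- exact: beta_star_refl.
Qed.

Lemma beta_star_apps t t' us :
  beta_star t t' -> beta_star (foldl LApp t us) (foldl LApp t' us).
Proof. by elim: us t t' => //= u us IH t t' tt'; apply/IH/beta_star_appl. Qed.

Lemma lclosed_at_leq k l t : k <= l -> lclosed_at k t -> lclosed_at l t.
Proof.
elim: t k l => [n|t IHt u IHu|t IHt] k l kl /=; first by move/leq_trans; apply.
- by case/andP=> /(IHt _ _ kl)-> /(IHu _ _ kl)->.
- exact: IHt.
Qed.

Lemma lift_closed_at k t : lclosed_at k t -> Defs.lift k t = t.
Proof.
elim: t k => [n|t IHt u IHu|t IHt] k /=; first by move->.
- by case/andP=> /IHt-> /IHu->.
- by move/IHt->.
Qed.

Lemma lsubst_closed_at k u t : lclosed_at k t -> lsubst k u t = t.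
Proof.
elim: t k u => [n|t IHt v IHv|t IHt] k u /=; first by move->.
- by case/andP=> /IHt-> /IHv->.
- by move/IHt->.
Qed.

(** Closedness is reflected, not only preserved, by substitution: one closed instance of a body
    shows that the abstraction is closed. *)
Lemma lclosed_at_lsubst k u t : lclosed_at k (lsubst k u t) -> lclosed_at k.+1 t.
Proof.
elim: t k u => [n|t IHt v IHv|t IHt] k u /=.
- case: ltnP => [/ltnW//|kn]; case: eqP => [->//|nk /=]; lia.
- by case/andP=> /IHt-> /IHv->.
- exact: IHt.
Qed.

(* Substitutes the closed terms [env] simultaneously for the indices
   [k], [k.+1], ..., and lowers the indices above these by [size env]. *)
Fixpoint close (k : nat) (env : seq lterm) (t : lterm) : lterm :=
  match t with
  | LVar n => if n < k then LVar n else nth (LVar (n - size env)) env (n - k)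
  | LApp t u => LApp (close k env t) (close k env u)
  | LLam t => LLam (close k.+1 env t)
  end.

Lemma close_closed_at k env t : lclosed_at k t -> close k env t = t.
Proof.
elim: t k => [n|t IHt v IHv|t IHt] k /=; first by move->.
- by case/andP=> /IHt-> /IHv->.
- by move/IHt->.
Qed.

(** This merges successive single substitutions into one environment; nothing has to be lifted, as
    all the substituted terms are closed. *)
Lemma lsubst_close k u env t : lclosed u -> all lclosed env ->
  lsubst k u (close k.+1 env t) = close k (u :: env) t.
Proof.
move=> cu cenv; elim: t k => [n|t IHt v IHv|t IHt] k /=.
- case: (ltngtP n k) => [nk|kn|->].
  + by rewrite ltnS (ltnW nk) /= nk.
  + rewrite ltnS leqNgt kn /= -[n - k]prednK ?subn_gt0//=.
    rewrite -subnS; case: (ltnP (n - k.+1) (size env)) => [lt|ge].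
      rewrite (set_nth_default (LVar (n - (size env).+1))) //.
      apply/lsubst_closed_at/(@lclosed_at_leq 0) => //.
      exact: (all_nthP _ cenv).
    rewrite !nth_default //=.
    have -> : n - size env < k = false by lia.
    have -> : n - size env == k = false by lia.
    congr LVar; lia.
  + by rewrite leqnn subnn /= ltnn eqxx.
- by rewrite IHt IHv.
- by rewrite (lift_closed_at cu) IHt.
Qed.

Lemma lclosed_at_close k env t : all lclosed env ->
  lclosed_at (k + size env) t -> lclosed_at k (close k env t).
Proof.
move=> cenv; elim: t k => [n|t IHt v IHv|t IHt] k /=.
- move=> lt; case: (ltnP n k) => // kn; apply: (@lclosed_at_leq 0) => //.
  have jn : n - k < size env by lia.
  exact: (all_nthP _ cenv _ jn).
- by case/andP=> /IHt-> /IHv->.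
- exact: (IHt k.+1).
Qed.

Lemma close_apps k env t us :
  close k env (foldl LApp t us) = foldl LApp (close k env t) (map (close k env) us).
Proof. by elim: us t => //= u us IH t; rewrite IH. Qed.

Lemma lclosed_at_apps k t us :
  lclosed_at k (foldl LApp t us) = lclosed_at k t && all (lclosed_at k) us.
Proof. by elim: us t => [|u us IH] t /=; rewrite ?andbT// IH andbA. Qed.

Lemma lclosed_at_lams k m t : lclosed_at k (iter m LLam t) = lclosed_at (k + m) t.
Proof. by elim: m k => [|m IH] k /=; rewrite ?addn0 // IH addSnnS. Qed.

(** Each argument is pushed in front of the environment, so the last one, bound by the innermost
    abstraction, gets index 0; hence [catrev]. *)
Lemma beta_star_lams env m t us : size us = m -> all lclosed env -> all lclosed us ->
  beta_star (foldl LApp (close 0 env (iter m LLam t)) us)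
            (close 0 (catrev us env) t).
Proof.
move=> <-{m}; elim: us env => [|u us IH] env cenv; first by move=> _; apply: beta_star_refl.
case/andP=> cu cus; apply: beta_star_trans (IH (u :: env) _ cus); last by rewrite /= cu.
rewrite /= -lsubst_close //; apply/beta_star_apps/Relation_Operators.rt_step/Beta.
Qed.

Lemma scott_closed k i cs : i < k -> all lclosed cs -> lclosed (scott k i cs).
Proof.
move=> ik cc; rewrite /lclosed lclosed_at_lams lclosed_at_apps /=.
apply/andP; split; first by lia.
by apply: sub_all cc => c; apply: lclosed_at_leq.
Qed.

Lemma close_closed_seq k env us : all lclosed us -> map (close k env) us = us.
Proof.
elim: us => //= u us IH /andP[cu /IH->].
by rewrite close_closed_at //; apply: lclosed_at_leq cu.
Qed.

Lemma scott_select k i cs bs : i < k -> size bs = k -> all lclosed cs -> all lclosed bs ->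
  beta_star (foldl LApp (scott k i cs) bs) (foldl LApp (nth (LVar 0) bs i) cs).
Proof.
move=> ik sbs ccs cbs.
have -> : scott k i cs = close 0 [::] (scott k i cs).
  by rewrite close_closed_at //; apply: scott_closed.
apply: beta_star_trans (beta_star_lams _ _ _ _) _ => //.
rewrite close_apps close_closed_seq //= subn0 catrevE cats0.
rewrite nth_rev; last by lia.
rewrite sbs (_ : k - (k - i.+1).+1 = i); last by lia.
by rewrite (set_nth_default (LVar 0)) ?sbs //; apply: beta_star_refl.
Qed.

(** * Recursion on Scott-encoded data *)

(* A constructor with [m] arguments is described by [m] and by the list of what
   its branch of the recursor receives: the pair [(j, q)] stands for
   [q F c_j], where [c_j] is the j-th argument and [F] the recursive function. *)
Definition constr := (nat * seq (nat * lterm))%type.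

Definition constr_ok (C : constr) := all (fun f => (f.1 < C.1) && lclosed f.2) C.2.

(** With m = [C.1], the indices below m are the arguments in reverse order, m is the scrutinee, m +
    1 is the body of the recursor, whose self-application is the recursive function, and the k step
    functions follow in reverse order. *)
Definition branch (k i : nat) (C : constr) : lterm :=
  iter C.1 LLam (foldl LApp (LVar (C.1.+2 + (k - i.+1)))
    [seq LApp (LApp f.2 (LApp (LVar C.1.+1) (LVar C.1.+1))) (LVar (C.1 - f.1.+1))
    | f <- C.2]).

Notation nth_constr := (nth (0, [::])).

(** Recursion by self-application: for O this body, [LApp O O] is the recursive function, which O
    rebuilds from its own first argument. *)
Definition rec_body (sig : seq constr) : lterm :=
  iter 2 LLam (foldl LApp (LVar 0)
    (mkseq (fun i => branch (size sig) i (nth_constr sig i)) (size sig))).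

Definition rec_term (sig : seq constr) : lterm :=
  iter (size sig) LLam (LApp (rec_body sig) (rec_body sig)).

Definition rec_fix (sig : seq constr) (ss : seq lterm) : lterm :=
  LApp (close 0 (rev ss) (rec_body sig)) (close 0 (rev ss) (rec_body sig)).

Lemma constr_ok_nth sig i : all constr_ok sig -> constr_ok (nth_constr sig i).
Proof.
move=> ok; case: (ltnP i (size sig)) => [lt|ge]; last by rewrite nth_default.
exact: (all_nthP _ ok).
Qed.

Lemma branch_closed k i C : constr_ok C -> i < k -> lclosed_at k.+2 (branch k i C).
Proof.
move=> ok ik; rewrite lclosed_at_lams lclosed_at_apps /= all_map.
apply/andP; split; first by lia.
apply: sub_all ok => -[j q] /andP[/= jC cq]; rewrite (lclosed_at_leq _ cq) //=; lia.
Qed.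

Lemma rec_body_closed sig : all constr_ok sig -> lclosed_at (size sig) (rec_body sig).
Proof.
move=> ok; rewrite lclosed_at_lams lclosed_at_apps addn2 /= all_map.
apply/allP=> i; rewrite mem_iota /= add0n => ik; apply: branch_closed => //.
exact: constr_ok_nth.
Qed.

Lemma rec_term_closed sig : all constr_ok sig -> lclosed (rec_term sig).
Proof. move=> ok; rewrite /lclosed lclosed_at_lams add0n.
by apply/andP; split; exact: rec_body_closed.
Qed.

Section Recursor.
Variables (sig : seq constr) (ss : seq lterm).
Hypotheses (ok : all constr_ok sig) (sss : size ss = size sig) (css : all lclosed ss).

Lemma rec_body_close_closed : lclosed (close 0 (rev ss) (rec_body sig)).
Proof.
apply: lclosed_at_close; first by rewrite all_rev.
by rewrite size_rev sss rec_body_closed.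
Qed.

Lemma rec_fix_closed : lclosed (rec_fix sig ss).
Proof. by apply/andP; split; exact: rec_body_close_closed. Qed.

Lemma rec_term_fix : beta_star (foldl LApp (rec_term sig) ss) (rec_fix sig ss).
Proof.
rewrite -[rec_term sig](close_closed_at [::] (rec_term_closed ok)).
apply: beta_star_trans (beta_star_lams _ _ _ _) _ => //.
by rewrite catrevE cats0; apply: beta_star_refl.
Qed.

(** Three rounds of reduction: the self-application unfolds, the Scott code selects its branch, and
    the branch consumes the constructor arguments. *)
Lemma rec_fix_step i cs : i < size sig -> size cs = (nth_constr sig i).1 ->
  all lclosed cs ->
  beta_star (LApp (rec_fix sig ss) (scott (size sig) i cs))
    (foldl LApp (nth (LVar 0) ss i)
       [seq LApp (LApp f.2 (rec_fix sig ss)) (nth (LVar 0) cs f.1)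
       | f <- (nth_constr sig i).2]).
Proof.
move=> ik scs ccs; set O := close 0 (rev ss) (rec_body sig).
have cO : lclosed O := rec_body_close_closed.
have cx : lclosed (scott (size sig) i cs) by apply: scott_closed.
have crev : all lclosed (rev ss) by rewrite all_rev.
set x := scott _ _ _ in cx *.
have -> : LApp (rec_fix sig ss) x = foldl LApp O [:: O; x] by [].
apply: beta_star_trans (beta_star_lams _ _ _ _) _ => //=; first by rewrite cO cx.
set env := [:: x, O & rev ss].
have cenv : all lclosed env by rewrite /= cO cx.
rewrite close_apps [close 0 env (LVar 0)]/=.
apply: beta_star_trans (scott_select _ _ _ _) _ => //.
- by rewrite size_map size_mkseq.
- rewrite !all_map; apply/allP=> j; rewrite mem_iota add0n /= => jk.
  apply: lclosed_at_close => //; rewrite /= size_rev sss.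
  by apply: branch_closed => //; apply: constr_ok_nth.
rewrite (nth_map (LVar 0)) ?size_mkseq // nth_mkseq //.
apply: beta_star_trans (beta_star_lams _ _ _ _) _ => //.
rewrite close_apps catrevE.
have -> : close 0 (rev cs ++ env) (LVar ((nth_constr sig i).1.+2 + (size sig - i.+1)))
          = nth (LVar 0) ss i.
  set d := size sig - i.+1; set m := (nth_constr sig i).1.
  rewrite /= subn0 nth_cat size_rev scs -/m.
  rewrite (_ : _ < m = false); last by lia.
  rewrite (_ : _ - m = d.+2) /=; last by lia.
  rewrite nth_rev sss /d; last by lia.
  rewrite (_ : size sig - (size sig - i.+1).+1 = i); last by lia.
  by apply: set_nth_default; rewrite sss.
rewrite -map_comp.
rewrite (_ : map _ _ = [seq LApp (LApp f.2 (rec_fix sig ss)) (nth (LVar 0) cs f.1)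
                       | f <- (nth_constr sig i).2]).
  exact: beta_star_refl.
have := constr_ok_nth i ok; rewrite /constr_ok.
elim: (nth_constr sig i).2 => //= -[j q] fs IH /andP[/andP[/= jm cq] /IH->].
congr (_ :: _).
move: scs jm; set m := (nth_constr sig i).1 => scs jm.
have m0 : m.+1 < m = false by rewrite ltnNge leqnSn.
have m1 : m - j.+1 < m by rewrite ltn_subrL (leq_trans _ jm).
have m2 : m - (m - j.+1).+1 = j by rewrite -subSn // subSS subKn // ltnW.
rewrite (close_closed_at _ cq) !subn0 !nth_cat size_rev scs m0 m1 subSnn.
rewrite nth_rev ?scs // m2.
by rewrite [X in LApp _ X](set_nth_default (LVar 0)) ?scs.
Qed.

End Recursor.

(** * Realizability *)

(* Realizers are closed under head expansion, so that they can be built without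
   normalizing; inhabitation is what makes abstractions closed in
   [denotes_lam]. *)
Record rty (T : Type) := Rty {
  realizes :> lterm -> T -> Prop;
  realizes_closed : forall t a, realizes t a -> lclosed t;
  realizes_back : forall t t' a,
    lclosed t -> beta_star t t' -> realizes t' a -> realizes t a;
  realizes_inh : exists t a, realizes t a }.

Definition base (T : Type) (code : T -> lterm) (a0 : T)
    (ccode : forall a, lclosed (code a)) : rty T.
Proof.
exists (fun t a => lclosed t /\ beta_star t (code a)).
- by move=> t a [].
- by move=> t t' a ct tt' [_ t'a]; split=> //; apply: beta_star_trans t'a.
- by exists (code a0), a0; split=> //; apply: beta_star_refl.
Defined.

Definition arr (T U : Type) (A : rty T) (B : rty U) : rty (T -> U).
Proof.
exists (fun t f => lclosed t /\ forall u a, A u a -> B (LApp t u) (f a)).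
- by move=> t f [].
- move=> t t' f ct tt' [_ t'f]; split=> // u a ua.
  apply: realizes_back (beta_star_appl u tt') (t'f _ _ ua).
  by rewrite /lclosed /= -!/(lclosed _) ct (realizes_closed ua).
- have [t [b tb]] := realizes_inh B.
  exists (LLam t), (fun=> b); split=> [|u a ua].
    exact: lclosed_at_leq (realizes_closed tb).
  have ct := realizes_closed tb; have cu := realizes_closed ua.
  apply: (@realizes_back _ B _ t) => //.
    by rewrite /lclosed /= (lclosed_at_leq (leqnSn 0) ct); apply: cu.
  rewrite -{2}[t](lsubst_closed_at u ct).
  exact/Relation_Operators.rt_step/Beta.
Defined.

Lemma realizes_app (T U : Type) (A : rty T) (B : rty U) t f u a :
  arr A B t f -> A u a -> B (LApp t u) (f a).
Proof. by case=> _; apply. Qed.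

(** A class, so that [denote] finds realizers of named functions by instance resolution. *)
Class realizable (T : Type) (A : rty T) (f : T) :=
  Realizable { realizer : lterm; realizerP : A realizer f }.
Arguments realizer {T A} f {_}.

(** Realizability of an open term: its free indices are filled by the environment, which grows when
    [denote] enters an abstraction. *)
Definition denotes (env : seq lterm) (T : Type) (A : rty T) (t : lterm) (a : T) :=
  all lclosed env -> A (close 0 env t) a.
Arguments denotes env {T} A t a.

Lemma denotes_const env T (A : rty T) f (rf : realizable A f) :
  denotes env A (realizer f) f.
Proof.
by move=> _; rewrite close_closed_at; [apply: realizerP | apply: realizes_closed realizerP].
Qed.

Lemma denotes_var env T (A : rty T) i a :
  A (nth (LVar (i - size env)) env i) a -> denotes env A (LVar i) a.
Proof. by move=> ia _; rewrite /= subn0. Qed.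

Lemma denotes_app env T U (A : rty T) (B : rty U) t u f a :
  denotes env (arr A B) t f -> denotes env A u a -> denotes env B (LApp t u) (f a).
Proof. by move=> tf ua cenv; apply: realizes_app (tf cenv) (ua cenv). Qed.

Lemma denotes_lam env T U (A : rty T) (B : rty U) t f :
  (forall u a, A u a -> denotes (u :: env) B t (f a)) ->
  denotes env (arr A B) (LLam t) f.
Proof.
move=> tf cenv; rewrite /=.
have cE u a (ua : A u a) : lsubst 0 u (close 1 env t) = close 0 (u :: env) t.
  by apply: lsubst_close => //; apply: realizes_closed ua.
have cl : lclosed (LLam (close 1 env t)).
  have [u [a ua]] := realizes_inh A.
  apply: (@lclosed_at_lsubst 0 u); rewrite (cE _ _ ua).
  by apply: realizes_closed (tf _ _ ua _); rewrite /= (realizes_closed ua).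
split=> // u a ua; have cu := realizes_closed ua.
apply: realizes_back (tf _ _ ua _).
- by apply/andP.
- rewrite -(cE _ _ ua); exact/Relation_Operators.rt_step/Beta.
- by rewrite /= cu.
Qed.

Lemma denotes_realizable T (A : rty T) t f : denotes [::] A t f -> realizable A f.
Proof. by move=> tf; exists (close 0 [::] t); apply: tf. Qed.

Ltac denote_var i :=
  match goal with H : realizes ?A _ ?a |- denotes _ _ _ ?a =>
    eapply (@denotes_var _ _ _ i); exact H end.

(** Instances are tried before an application is split, so that terms such as [tag true], whose
    Boolean argument has no realizers, are taken whole. *)
Ltac denote :=
  lazymatch goal with
  | |- denotes _ ?A _ ?e =>
    first
    [ is_var e;
      first [ denote_var 0 | denote_var 1 | denote_var 2 | denote_var 3
            | denote_var 4 | denote_var 5 | denote_var 6 | denote_var 7 ]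
    | let re := constr:(_ : realizable A e) in refine (denotes_const re)
    | lazymatch e with
      | fun x => _ => refine (denotes_lam _); intros; cbv beta; denote
      | ?f ?a => refine (denotes_app (f := f) (a := a) _ _); [denote | denote]
      end ]
  end.

Ltac realize := apply: denotes_realizable; denote.

(** * Codes of data as base types of realizers *)

Fixpoint term_ind' (P : term -> Prop) (PVar : forall x, P (Var x))
    (PFun : forall i ts, foldr (fun t => and (P t)) True ts -> P (Fun i ts)) t : P t :=
  match t with
  | Var x => PVar x
  | Fun i ts => PFun i ts ((fix all_P ts : foldr (fun t => and (P t)) True ts :=
      match ts with
      | [::] => I
      | t :: ts => conj (term_ind' PVar PFun t) (all_P ts)
      end) ts)
  end.

Lemma code_nat_closed n : lclosed (code_nat n).
Proof. by elim: n => // n IH; apply: scott_closed; rewrite //= IH. Qed.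

Lemma code_seq_closed T (code : T -> lterm) s :
  foldr (fun x => and (lclosed (code x))) True s -> lclosed (code_seq code s).
Proof. by elim: s => // x s IH [cx /IH cs]; apply: scott_closed; rewrite //= cx cs. Qed.

Lemma foldr_and T (P : T -> Prop) s : (forall x, P x) -> foldr (fun x => and (P x)) True s.
Proof. by move=> PT; elim: s => //=. Qed.

Lemma code_pair_closed p : lclosed (code_pair p).
Proof. by apply: scott_closed; rewrite //= !code_nat_closed. Qed.

Lemma code_term_closed t : lclosed (code_term t).
Proof.
elim/term_ind': t => [x|i ts ih]; apply: scott_closed; rewrite //= code_nat_closed //=.
by rewrite andbT; apply: code_seq_closed.
Qed.

Lemma code_terms_closed ts : lclosed (code_seq code_term ts).
Proof. exact/code_seq_closed/foldr_and/code_term_closed. Qed.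

Lemma code_pairs_closed ps : lclosed (code_seq code_pair ps).
Proof. exact/code_seq_closed/foldr_and/code_pair_closed. Qed.

Lemma code_atom_closed l : lclosed (code_atom l).
Proof.
by case: l => [t u|i ts]; apply: scott_closed;
  rewrite //= ?code_term_closed ?code_nat_closed ?code_terms_closed.
Qed.

Lemma code_fot_closed phi : lclosed (code_fot phi).
Proof.
by elim: phi => *; apply: scott_closed; rewrite //= ?andbT; do ?[apply/andP; split];
  rewrite ?code_atom_closed ?code_pairs_closed ?code_nat_closed.
Qed.

Lemma code_so_closed phi : lclosed (code_so phi).
Proof.
by elim: phi => *; apply: scott_closed; rewrite //= ?andbT; do ?[apply/andP; split];
  rewrite ?code_atom_closed ?code_terms_closed ?code_nat_closed.
Qed.

Definition natR := base 0 code_nat_closed.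
Definition termR := base (Var 0) code_term_closed.
Definition termsR := base [::] code_terms_closed.
Definition pairR := base (0, 0) code_pair_closed.
Definition pairsR := base [::] code_pairs_closed.
Definition atomR := base (Rel 0 [::]) code_atom_closed.
Definition fotR := base (FNeq [::]) code_fot_closed.
Definition soR := base (SRel 0 [::]) code_so_closed.

(** * Realizers of the constructors *)

Lemma beta_star_lam t t' : beta_star t t' -> beta_star (LLam t) (LLam t').
Proof.
elim=> [v w b|v|v w x _ IH1 _ IH2]; last exact: beta_star_trans IH1 IH2.
- by apply: Relation_Operators.rt_step; apply: BetaLam.
- exact: beta_star_refl.
Qed.

(** Arguments of a constructor are realizers that merely reduce to codes, and they sit below the
    abstractions of the Scott code: here reduction under abstractions is essential. *)
Lemma beta_star_scott k i cs cs' : size cs = size cs' ->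
  (forall j, j < size cs -> beta_star (nth (LVar 0) cs j) (nth (LVar 0) cs' j)) ->
  beta_star (scott k i cs) (scott k i cs').
Proof.
move=> scs red; rewrite /scott.
elim: k (LVar (k - i.+1)) => [|k IH] t /=; last exact/beta_star_lam/IH.
elim: cs cs' t scs red => [|c cs IH] [|c' cs'] t //=.
  by move=> _ _; apply: beta_star_refl.
move=> /succn_inj scs red.
apply: beta_star_trans (beta_star_apps _ (beta_star_appr _ (red 0 _))) _ => //=.
by apply: IH => // j; apply: (red j.+1).
Qed.

Definition constr_term (k i m : nat) :=
  iter m LLam (scott k i (mkseq (fun j => LVar (k + (m - j.+1))) m)).

Lemma constr_term_closed k i m : i < k -> lclosed (constr_term k i m).
Proof.
move=> ik; rewrite /lclosed !lclosed_at_lams lclosed_at_apps /=.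
apply/andP; split; first by lia.
by rewrite all_map; apply/allP=> j; rewrite mem_iota /=; lia.
Qed.

Lemma close_lams k env m t :
  close k env (iter m LLam t) = iter m LLam (close (k + m) env t).
Proof. by elim: m k => [|m IH] k /=; rewrite ?addn0 // IH addSnnS. Qed.

Lemma constr_term_red k i cs : i < k -> all lclosed cs ->
  beta_star (foldl LApp (constr_term k i (size cs)) cs) (scott k i cs).
Proof.
move=> ik ccs.
rewrite -[constr_term _ _ _](close_closed_at [::] (constr_term_closed _ ik)).
apply: beta_star_trans (beta_star_lams _ _ _ _) _ => //.
rewrite catrevE cats0 close_lams close_apps /= add0n (_ : _ < k); last by lia.
rewrite (_ : map _ _ = cs); first exact: beta_star_refl.
apply: (@eq_from_nth _ (LVar 0)); rewrite ?size_map ?size_iota // => j jcs.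
rewrite (nth_map (LVar 0)) ?size_map ?size_iota // nth_mkseq //=.
have -> : k + (size cs - j.+1) < k = false by lia.
rewrite addKn nth_rev; last by lia.
rewrite (_ : _ - (_ - j.+1).+1 = j); last by lia.
exact: set_nth_default.
Qed.

Lemma realizable_base T code (a0 : T) ccode a : realizable (@base T code a0 ccode) a.
Proof. by exists (code a); split; [apply: ccode | apply: beta_star_refl]. Qed.

Section Constructors.
Variables (T1 T2 T3 T : Type) (code1 : T1 -> lterm) (code2 : T2 -> lterm).
Variables (code3 : T3 -> lterm) (code : T -> lterm) (x1 : T1) (x2 : T2) (x3 : T3) (x : T).
Hypotheses (c1 : forall a, lclosed (code1 a)) (c2 : forall a, lclosed (code2 a)).
Hypotheses (c3 : forall a, lclosed (code3 a)) (c : forall a, lclosed (code a)).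

Lemma constr_term_realizes k i cs cs' a : i < k -> size cs = size cs' -> all lclosed cs ->
  (forall j, j < size cs -> beta_star (nth (LVar 0) cs j) (nth (LVar 0) cs' j)) ->
  code a = scott k i cs' -> base x c (foldl LApp (constr_term k i (size cs)) cs) a.
Proof.
move=> ik scs ccs red codea; split.
  rewrite /lclosed lclosed_at_apps -!/(lclosed _) -/(constr_term _ _ _).
  by apply/andP; split=> //; apply: constr_term_closed.
apply: beta_star_trans (constr_term_red ik ccs) _.
by rewrite codea; apply: beta_star_scott.
Qed.

Lemma realizable_constr1 k i (f : T1 -> T) : i < k ->
  (forall a1, code (f a1) = scott k i [:: code1 a1]) ->
  realizable (arr (base x1 c1) (base x c)) f.
Proof.
move=> ik codef; exists (constr_term k i 1); split=> [|u1 a1 [cu1 r1]].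
  exact: constr_term_closed.
apply: (@constr_term_realizes k i [:: u1] [:: code1 a1]) => //=; first by rewrite cu1.
by case.
Qed.

Lemma realizable_constr2 k i (f : T1 -> T2 -> T) : i < k ->
  (forall a1 a2, code (f a1 a2) = scott k i [:: code1 a1; code2 a2]) ->
  realizable (arr (base x1 c1) (arr (base x2 c2) (base x c))) f.
Proof.
move=> ik codef; exists (constr_term k i 2).
have ct := constr_term_closed 2 ik.
split=> // u1 a1 [cu1 r1]; split=> [|u2 a2 [cu2 r2]]; first exact/andP.
apply: (@constr_term_realizes k i [:: u1; u2] [:: code1 a1; code2 a2]) => //=.
  by rewrite cu1 cu2.
by case=> [|[|]].
Qed.

Lemma realizable_constr3 k i (f : T1 -> T2 -> T3 -> T) : i < k ->
  (forall a1 a2 a3, code (f a1 a2 a3) = scott k i [:: code1 a1; code2 a2; code3 a3]) ->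
  realizable (arr (base x1 c1) (arr (base x2 c2) (arr (base x3 c3) (base x c)))) f.
Proof.
move=> ik codef; exists (constr_term k i 3).
have ct := constr_term_closed 3 ik.
split=> // u1 a1 [cu1 r1]; split=> [|u2 a2 [cu2 r2]]; first exact/andP.
split=> [|u3 a3 [cu3 r3]]; first by apply/andP; split=> //; apply/andP.
apply: (@constr_term_realizes k i [:: u1; u2; u3] [:: code1 a1; code2 a2; code3 a3]) => //=.
  by rewrite cu1 cu2 cu3.
by case=> [|[|[|]]].
Qed.

End Constructors.

#[local] Instance realizable_0 : realizable natR 0 := realizable_base _ _ _.
#[local] Instance realizable_S : realizable (arr natR natR) S.
Proof. exact: (@realizable_constr1 _ _ _ _ _ _ _ _ 2 1). Qed.
#[local] Instance realizable_Var : realizable (arr natR termR) Var.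
Proof. exact: (@realizable_constr1 _ _ _ _ _ _ _ _ 2 0). Qed.
#[local] Instance realizable_Fun : realizable (arr natR (arr termsR termR)) Fun.
Proof. exact: (@realizable_constr2 _ _ _ _ _ _ _ _ _ _ _ _ 2 1). Qed.
#[local] Instance realizable_nil_term : realizable termsR [::] := realizable_base _ _ _.
#[local] Instance realizable_cons_term : realizable (arr termR (arr termsR termsR)) cons.
Proof. exact: (@realizable_constr2 _ _ _ _ _ _ _ _ _ _ _ _ 2 1). Qed.
#[local] Instance realizable_Eq : realizable (arr termR (arr termR atomR)) Eq.
Proof. exact: (@realizable_constr2 _ _ _ _ _ _ _ _ _ _ _ _ 2 0). Qed.
#[local] Instance realizable_Rel : realizable (arr natR (arr termsR atomR)) Rel.
Proof. exact: (@realizable_constr2 _ _ _ _ _ _ _ _ _ _ _ _ 2 1). Qed.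
#[local] Instance realizable_FAtom : realizable (arr atomR fotR) FAtom.
Proof. exact: (@realizable_constr1 _ _ _ _ _ _ _ _ 8 0). Qed.
#[local] Instance realizable_FNot : realizable (arr fotR fotR) FNot.
Proof. exact: (@realizable_constr1 _ _ _ _ _ _ _ _ 8 2). Qed.
#[local] Instance realizable_FAnd : realizable (arr fotR (arr fotR fotR)) FAnd.
Proof. exact: (@realizable_constr2 _ _ _ _ _ _ _ _ _ _ _ _ 8 3). Qed.
#[local] Instance realizable_FOr : realizable (arr fotR (arr fotR fotR)) FOr.
Proof. exact: (@realizable_constr2 _ _ _ _ _ _ _ _ _ _ _ _ 8 4). Qed.
#[local] Instance realizable_FEx : realizable (arr natR (arr fotR fotR)) FEx.
Proof. exact: (@realizable_constr2 _ _ _ _ _ _ _ _ _ _ _ _ 8 5). Qed.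
#[local] Instance realizable_FAll : realizable (arr natR (arr fotR fotR)) FAll.
Proof. exact: (@realizable_constr2 _ _ _ _ _ _ _ _ _ _ _ _ 8 6). Qed.
#[local] Instance realizable_FImp : realizable (arr fotR (arr fotR fotR)) FImp.
Proof. exact: (@realizable_constr2 _ _ _ _ _ _ _ _ _ _ _ _ 8 7). Qed.
#[local] Instance realizable_SAtom : realizable (arr atomR soR) SAtom.
Proof. exact: (@realizable_constr1 _ _ _ _ _ _ _ _ 9 0). Qed.
#[local] Instance realizable_SRel : realizable (arr natR (arr termsR soR)) SRel.
Proof. exact: (@realizable_constr2 _ _ _ _ _ _ _ _ _ _ _ _ 9 1). Qed.
#[local] Instance realizable_SNot : realizable (arr soR soR) SNot.
Proof. exact: (@realizable_constr1 _ _ _ _ _ _ _ _ 9 2). Qed.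
#[local] Instance realizable_SAnd : realizable (arr soR (arr soR soR)) SAnd.
Proof. exact: (@realizable_constr2 _ _ _ _ _ _ _ _ _ _ _ _ 9 3). Qed.
#[local] Instance realizable_SOr : realizable (arr soR (arr soR soR)) SOr.
Proof. exact: (@realizable_constr2 _ _ _ _ _ _ _ _ _ _ _ _ 9 4). Qed.
#[local] Instance realizable_SEx : realizable (arr natR (arr soR soR)) SEx.
Proof. exact: (@realizable_constr2 _ _ _ _ _ _ _ _ _ _ _ _ 9 5). Qed.
#[local] Instance realizable_SAll : realizable (arr natR (arr soR soR)) SAll.
Proof. exact: (@realizable_constr2 _ _ _ _ _ _ _ _ _ _ _ _ 9 6). Qed.
#[local] Instance realizable_SEx2 : realizable (arr natR (arr natR (arr soR soR))) SEx2.
Proof. exact: (@realizable_constr3 _ _ _ _ _ _ _ _ _ _ _ _ _ _ _ _ 9 7). Qed.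
#[local] Instance realizable_SAll2 : realizable (arr natR (arr natR (arr soR soR))) SAll2.
Proof. exact: (@realizable_constr3 _ _ _ _ _ _ _ _ _ _ _ _ _ _ _ _ 9 8). Qed.

(** * Realizers of recursion and case distinction *)

Definition arg_id := LLam (LLam (LVar 0)).
Definition arg_rec := LLam (LLam (LApp (LVar 1) (LVar 0))).

Lemma realizes_apps2 T (B : rty T) m F c v : lclosed_at 2 m -> lclosed F -> lclosed c ->
  B (close 0 [:: c; F] m) v -> B (LApp (LApp (LLam (LLam m)) F) c) v.
Proof.
move=> cm cF cc mv; apply: realizes_back mv; first by rewrite /lclosed /= cm; apply/andP.
have -> : LLam (LLam m) = close 0 [::] (iter 2 LLam m) by rewrite /= close_closed_at.
by apply: (@beta_star_lams [::] 2 m [:: F; c]); rewrite //= cF cc.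
Qed.

Lemma realizes_arg_id T (A : rty T) F c a :
  lclosed F -> A c a -> A (LApp (LApp arg_id F) c) a.
Proof. by move=> cF ca; apply: realizes_apps2 => //; apply: realizes_closed ca. Qed.

Lemma realizes_arg_rec T (A : rty T) F c a : lclosed F -> lclosed c ->
  A (LApp F c) a -> A (LApp (LApp arg_rec F) c) a.
Proof. by move=> cF cc ca; apply: realizes_apps2. Qed.

Section RecRealizes.
Variables (sig : seq constr) (ss : seq lterm).
Hypotheses (ok : all constr_ok sig) (sss : size ss = size sig) (css : all lclosed ss).

Lemma realizes_rec T (B : rty T) t c v : lclosed t -> beta_star t c ->
  B (LApp (rec_fix sig ss) c) v -> B (LApp (foldl LApp (rec_term sig) ss) t) v.
Proof.
move=> ct tc; apply: realizes_back.
  have cr : lclosed (foldl LApp (rec_term sig) ss).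
    by rewrite /lclosed lclosed_at_apps; apply/andP; split=> //; apply: rec_term_closed.
  by apply/andP.
by apply: beta_star_trans (beta_star_appl _ _) (beta_star_appr _ tc); apply: rec_term_fix.
Qed.

Lemma realizes_rec_step T (B : rty T) i cs v : i < size sig ->
  size cs = (nth_constr sig i).1 -> all lclosed cs ->
  B (foldl LApp (nth (LVar 0) ss i)
       [seq LApp (LApp f.2 (rec_fix sig ss)) (nth (LVar 0) cs f.1)
       | f <- (nth_constr sig i).2]) v ->
  B (LApp (rec_fix sig ss) (scott (size sig) i cs)) v.
Proof.
move=> ik scs ccs; apply: realizes_back; last exact: rec_fix_step.
by apply/andP; split; [apply: rec_fix_closed | apply: scott_closed].
Qed.

End RecRealizes.

Lemma arr_intro T U (A : rty T) (B : rty U) t f : lclosed t ->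
  (forall u a, lclosed u -> lclosed (LApp t u) -> A u a -> B (LApp t u) (f a)) ->
  arr A B t f.
Proof.
move=> ct tf; split=> // u a ua; have cu := realizes_closed ua.
by apply: tf => //; apply/andP.
Qed.

Lemma code_realizes T code (a0 : T) ccode a : @base T code a0 ccode (code a) a.
Proof. by split; [apply: ccode | apply: beta_star_refl]. Qed.

(** Recursion enters the realizers only through these combinators, [foldr] and [term_fold]; the
    translations are later rewritten in terms of them. *)
Fixpoint natrec (T : Type) (b : T) (s : nat -> T -> T) n :=
  if n is n.+1 then s n (natrec b s n) else b.

Definition fot_fold (T : Type) (sA : atom -> T) (sN : seq (nat * nat) -> T) (sNot : T -> T)
    (sAnd sOr : T -> T -> T) (sEx sAll : nat -> T -> T) (sImp : T -> T -> T) :=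
  fix fold (phi : fot) : T :=
  match phi with
  | FAtom l => sA l
  | FNeq xys => sN xys
  | FNot phi => sNot (fold phi)
  | FAnd phi psi => sAnd (fold phi) (fold psi)
  | FOr phi psi => sOr (fold phi) (fold psi)
  | FEx x phi => sEx x (fold phi)
  | FAll x phi => sAll x (fold phi)
  | FImp phi psi => sImp (fold phi) (fold psi)
  end.

Definition so_fold (T : Type) (sA : atom -> T) (sR : nat -> seq term -> T) (sNot : T -> T)
    (sAnd sOr : T -> T -> T) (sEx sAll : nat -> T -> T)
    (sEx2 sAll2 : nat -> nat -> T -> T) :=
  fix fold (phi : so) : T :=
  match phi with
  | SAtom l => sA l
  | SRel i ts => sR i ts
  | SNot phi => sNot (fold phi)
  | SAnd phi psi => sAnd (fold phi) (fold psi)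
  | SOr phi psi => sOr (fold phi) (fold psi)
  | SEx x phi => sEx x (fold phi)
  | SAll x phi => sAll x (fold phi)
  | SEx2 i n phi => sEx2 i n (fold phi)
  | SAll2 i n phi => sAll2 i n (fold phi)
  end.

Definition atom_case (T : Type) (sE : term -> term -> T) (sR : nat -> seq term -> T)
    (l : atom) :=
  match l with Eq t u => sE t u | Rel i ts => sR i ts end.

Definition pair_case (T : Type) (s : nat -> nat -> T) (p : nat * nat) :=
  let: (n, m) := p in s n m.

Ltac closeds :=
  first
  [ assumption | exact: rec_fix_closed
  | exact: code_nat_closed | exact: code_pairs_closed | exact: code_term_closed
  | exact: code_terms_closed | exact: code_atom_closed
  | exact: code_fot_closed | exact: code_so_closed | done
  | apply/andP; split; closeds ].

Ltac args :=
  lazymatch goal with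
  | |- realizes _ (LApp (LApp arg_id _) _) _ => apply: realizes_arg_id; [closeds | args]
  | |- realizes _ (LApp (LApp arg_rec _) _) _ =>
    apply: realizes_arg_rec; [closeds | closeds | args]
  | |- realizes _ (LApp (rec_fix _ _) _) _ => assumption
  | |- realizes _ (LApp _ _) _ => eapply realizes_app; [args | args]
  | |- realizes _ _ _ => first [eassumption | exact: code_realizes]
  end.

#[local] Instance realizable_natrec T (B : rty T) :
  realizable (arr B (arr (arr natR (arr B B)) (arr natR B))) (@natrec T).
Proof.
pose sig := [:: (0, [::]); (1, [:: (0, arg_id); (0, arg_rec)])].
exists (rec_term sig); apply: arr_intro => [|s0 f0 c0 k0 r0]; first exact: rec_term_closed.
apply: arr_intro => // s1 f1 c1 k1 r1; apply: arr_intro => // t n _ _ [ct tn].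
have css : all lclosed [:: s0; s1] by closeds.
apply: (realizes_rec (sig := sig) (ss := [:: s0; s1])) tn _ => // {ct}.
elim: n => [|n IH]; first exact: (realizes_rec_step _ _ css (i := 0) (cs := [::])).
apply: (realizes_rec_step _ _ css (i := 1) (cs := [:: code_nat n])) => //=;
  [closeds | args].
Qed.

#[local] Instance realizable_pair_case T (B : rty T) :
  realizable (arr (arr natR (arr natR B)) (arr pairR B)) (@pair_case T).
Proof.
pose sig := [:: (2, [:: (0, arg_id); (1, arg_id)])].
exists (rec_term sig); apply: arr_intro => [|s0 f0 c0 k0 r0]; first exact: rec_term_closed.
apply: arr_intro => // t [n m] _ _ [ct tn].
have css : all lclosed [:: s0] by closeds.
apply: (realizes_rec (sig := sig) (ss := [:: s0])) tn _ => // {ct}.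
apply: (realizes_rec_step _ _ css (i := 0)) => //=; [closeds | args].
Qed.

#[local] Instance realizable_atom_case T (B : rty T) :
  realizable (arr (arr termR (arr termR B)) (arr (arr natR (arr termsR B)) (arr atomR B)))
    (@atom_case T).
Proof.
pose sig := [:: (2, [:: (0, arg_id); (1, arg_id)]); (2, [:: (0, arg_id); (1, arg_id)])].
exists (rec_term sig); apply: arr_intro => [|s0 f0 c0 k0 r0]; first exact: rec_term_closed.
apply: arr_intro => // s1 f1 c1 k1 r1; apply: arr_intro => // t l _ _ [ct tl].
have css : all lclosed [:: s0; s1] by closeds.
apply: (realizes_rec (sig := sig) (ss := [:: s0; s1])) tl _ => // {ct}.
case: l => [u v|i ts].
- apply: (realizes_rec_step _ _ css (i := 0)) => //=; [closeds | args].
- apply: (realizes_rec_step _ _ css (i := 1)) => //=; [closeds | args].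
Qed.

#[local] Instance realizable_fot_fold T (B : rty T) :
  realizable (arr (arr atomR B) (arr (arr pairsR B) (arr (arr B B)
   (arr (arr B (arr B B)) (arr (arr B (arr B B))
   (arr (arr natR (arr B B)) (arr (arr natR (arr B B)) (arr (arr B (arr B B))
   (arr fotR B))))))))) (@fot_fold T).
Proof.
pose data := (1, [:: (0, arg_id)]).
pose one := (1, [:: (0, arg_rec)]).
pose two := (2, [:: (0, arg_rec); (1, arg_rec)]).
pose quant := (2, [:: (0, arg_id); (1, arg_rec)]).
pose sig := [:: data; data; one; two; two; quant; quant; two].
exists (rec_term sig); apply: arr_intro => [|s0 f0 c0 k0 r0]; first exact: rec_term_closed.
apply: arr_intro => // s1 f1 c1 k1 r1; apply: arr_intro => // s2 f2 c2 k2 r2.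
apply: arr_intro => // s3 f3 c3 k3 r3; apply: arr_intro => // s4 f4 c4 k4 r4.
apply: arr_intro => // s5 f5 c5 k5 r5; apply: arr_intro => // s6 f6 c6 k6 r6.
apply: arr_intro => // s7 f7 c7 k7 r7; apply: arr_intro => // t phi _ _ [ct tphi].
set ss := [:: s0; s1; s2; s3; s4; s5; s6; s7].
have css : all lclosed ss by closeds.
apply: (realizes_rec (sig := sig) (ss := ss)) tphi _ => // {ct}.
elim: phi => [l|ps|phi IH|phi IH psi IH'|phi IH psi IH'|x phi IH|x phi IH
  |phi IH psi IH'].
- apply: (realizes_rec_step _ _ css (i := 0)) => //=; [closeds | args].
- apply: (realizes_rec_step _ _ css (i := 1)) => //=; [closeds | args].
- apply: (realizes_rec_step _ _ css (i := 2)) => //=; [closeds | args].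
- apply: (realizes_rec_step _ _ css (i := 3)) => //=; [closeds | args].
- apply: (realizes_rec_step _ _ css (i := 4)) => //=; [closeds | args].
- apply: (realizes_rec_step _ _ css (i := 5)) => //=; [closeds | args].
- apply: (realizes_rec_step _ _ css (i := 6)) => //=; [closeds | args].
- apply: (realizes_rec_step _ _ css (i := 7)) => //=; [closeds | args].
Qed.

#[local] Instance realizable_so_fold T (B : rty T) :
  realizable (arr (arr atomR B) (arr (arr natR (arr termsR B)) (arr (arr B B)
   (arr (arr B (arr B B)) (arr (arr B (arr B B))
   (arr (arr natR (arr B B)) (arr (arr natR (arr B B))
   (arr (arr natR (arr natR (arr B B))) (arr (arr natR (arr natR (arr B B)))
   (arr soR B)))))))))) (@so_fold T).
Proof.
pose data := (1, [:: (0, arg_id)]).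
pose data2 := (2, [:: (0, arg_id); (1, arg_id)]).
pose one := (1, [:: (0, arg_rec)]).
pose two := (2, [:: (0, arg_rec); (1, arg_rec)]).
pose quant := (2, [:: (0, arg_id); (1, arg_rec)]).
pose quant2 := (3, [:: (0, arg_id); (1, arg_id); (2, arg_rec)]).
pose sig := [:: data; data2; one; two; two; quant; quant; quant2; quant2].
exists (rec_term sig); apply: arr_intro => [|s0 f0 c0 k0 r0]; first exact: rec_term_closed.
apply: arr_intro => // s1 f1 c1 k1 r1; apply: arr_intro => // s2 f2 c2 k2 r2.
apply: arr_intro => // s3 f3 c3 k3 r3; apply: arr_intro => // s4 f4 c4 k4 r4.
apply: arr_intro => // s5 f5 c5 k5 r5; apply: arr_intro => // s6 f6 c6 k6 r6.
apply: arr_intro => // s7 f7 c7 k7 r7; apply: arr_intro => // s8 f8 c8 k8 r8.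
apply: arr_intro => // t phi _ _ [ct tphi].
set ss := [:: s0; s1; s2; s3; s4; s5; s6; s7; s8].
have css : all lclosed ss by closeds.
apply: (realizes_rec (sig := sig) (ss := ss)) tphi _ => // {ct}.
elim: phi => [l|i ts|phi IH|phi IH psi IH'|phi IH psi IH'|x phi IH|x phi IH
  |i n phi IH|i n phi IH].
- apply: (realizes_rec_step _ _ css (i := 0)) => //=; [closeds | args].
- apply: (realizes_rec_step _ _ css (i := 1)) => //=; [closeds | args].
- apply: (realizes_rec_step _ _ css (i := 2)) => //=; [closeds | args].
- apply: (realizes_rec_step _ _ css (i := 3)) => //=; [closeds | args].
- apply: (realizes_rec_step _ _ css (i := 4)) => //=; [closeds | args].
- apply: (realizes_rec_step _ _ css (i := 5)) => //=; [closeds | args].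
- apply: (realizes_rec_step _ _ css (i := 6)) => //=; [closeds | args].
- apply: (realizes_rec_step _ _ css (i := 7)) => //=; [closeds | args].
- apply: (realizes_rec_step _ _ css (i := 8)) => //=; [closeds | args].
Qed.

Definition seq_sig := [:: (0, [::]); (2, [:: (0, arg_id); (1, arg_rec)])].

Lemma realizable_foldr A code (a0 : A) ccode s0 cseq T (B : rty T) :
  realizable (arr (arr (@base A code a0 ccode) (arr B B))
                  (arr B (arr (@base _ (code_seq code) s0 cseq) B))) foldr.
Proof.
(* The recursor expects the branch of [[::]] first, whereas [foldr] takes the step function first;
   the arguments are swapped at the end. *)
have [p [cp rp]] : realizable (arr B (arr (arr (base a0 ccode) (arr B B))
    (arr (base s0 cseq) B))) (fun b f => foldr f b).
  exists (rec_term seq_sig); apply: arr_intro => [|u0 f0 c0 k0 r0].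
    exact: rec_term_closed.
  apply: arr_intro => // u1 f1 c1 k1 r1; apply: arr_intro => // t s _ _ [ct ts].
  have css : all lclosed [:: u0; u1] by rewrite /= c0 c1.
  apply: (realizes_rec (sig := seq_sig) (ss := [:: u0; u1])) ts _ => // {ct}.
  have cF : lclosed (rec_fix seq_sig [:: u0; u1]) by apply: rec_fix_closed.
  elim: s => [|x s IH].
    exact: (realizes_rec_step _ _ css (i := 0) (cs := [::])).
  apply: (realizes_rec_step _ _ css (i := 1) (cs := [:: code x; code_seq code s])) => //=.
    by rewrite ccode; move: (cseq s) => /= ->.
  apply: realizes_app; last by apply: realizes_arg_rec IH => //; apply: cseq.
  by apply: realizes_app r1 _; apply: realizes_arg_id => //; apply: code_realizes.
pose g b f s := @foldr A T f b s.
have inst : realizable (arr B (arr (arr (base a0 ccode) (arr B B))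
    (arr (base s0 cseq) B))) g by exists p.
change (realizable (arr (arr (base a0 ccode) (arr B B)) (arr B (arr (base s0 cseq) B)))
  (fun f b s => g b f s)).
realize.
Qed.

(* [F] is only assumed to be correct on the elements of the list, since it
   will be the recursive function itself. *)
Definition arg_map := LLam (LLam
  (LApp (LApp (LApp (rec_term seq_sig) (scott 2 0 [::]))
    (LLam (LLam (LApp (LApp (constr_term 2 1 2) (LApp (LVar 3) (LVar 1))) (LVar 0)))))
    (LVar 0))).

Lemma realizes_arg_map A (codeA : A -> lterm) T (code : T -> lterm) x ccode s0 cseq F f s :
  (forall a, lclosed (codeA a)) -> lclosed (code_seq codeA s) -> lclosed F ->
  foldr (fun a => and (@base T code x ccode (LApp F (codeA a)) (f a))) True s ->
  @base _ (code_seq code) s0 cseq (LApp (LApp arg_map F) (code_seq codeA s)) (map f s).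
Proof.
move=> ccA cs cF Fs; apply: realizes_apps2 => //.
pose nilc := scott 2 0 [::].
pose s1 := LLam (LLam (LApp (LApp (constr_term 2 1 2) (LApp F (LVar 1))) (LVar 0))).
rewrite (_ : close _ _ _ =
  LApp (foldl LApp (rec_term seq_sig) [:: nilc; s1]) (code_seq codeA s)) //.
have cs1 : lclosed s1.
  by rewrite /s1 /lclosed /= (lclosed_at_leq _ (cF : lclosed_at 0 F)).
have css : all lclosed [:: nilc; s1] by rewrite /= cs1.
apply: (realizes_rec (sig := seq_sig) _ _ _ _ (beta_star_refl _)) => //.
have crec : lclosed (rec_fix seq_sig [:: nilc; s1]) by apply: rec_fix_closed.
elim: s Fs {cs} => [|a s IH] Fs.
  apply: (realizes_rec_step _ _ css (i := 0) (cs := [::])) => //=.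
  exact: (@code_realizes _ (code_seq code) s0 cseq [::]).
have ccs : lclosed (code_seq codeA s).
  by elim: (s) => // b s' ccs'; apply: scott_closed; rewrite //= ccA ccs'.
apply: (realizes_rec_step _ _ css (i := 1) (cs := [:: codeA a; code_seq codeA s])) => //=.
  by rewrite ccA ccs.
case: Fs => -[_ Fa] /IH Fs.
have [cu ru] := realizes_arg_id crec (code_realizes a ccA a).
have [cv rv] := realizes_arg_rec crec ccs Fs.
move: (LApp (LApp arg_id _) _) (LApp (LApp arg_rec _) _) cu ru cv rv => u v cu ru cv rv.
have cFu : lclosed (LApp F u) by apply/andP.
suff : realizes (base s0 cseq) (LApp (LApp s1 u) v) (f a :: map f s) by [].
rewrite /s1; apply: realizes_apps2 => //.
rewrite (_ : close _ _ _ = foldl LApp (constr_term 2 1 2) [:: LApp F u; v]); last first.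
  by rewrite -[in RHS](@close_closed_at 0 [:: v; u] F).
apply: (@constr_term_realizes _ _ _ _ 2 1 [:: LApp F u; v]
  [:: code (f a); code_seq code (map f s)]) => //.
  by rewrite /= cFu cv.
by case=> [|[|]] //= _; apply: beta_star_trans (beta_star_appr _ ru) Fa.
Qed.

Definition term_fold T (sV : nat -> T) (sF : nat -> seq T -> T) :=
  fix fold (t : term) : T :=
  match t with
  | Var x => sV x
  | Fun i ts => sF i (map fold ts)
  end.

(** The results for the arguments of a function symbol are collected in a coded list; hence the
    result type is one of codes and not an arbitrary [rty]. *)
Lemma realizable_term_fold T (code : T -> lterm) x ccode s0 cseq :
  let B := @base T code x ccode in let Bs := @base _ (code_seq code) s0 cseq in
  realizable (arr (arr natR B) (arr (arr natR (arr Bs B)) (arr termR B))) (@term_fold T).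
Proof.
move=> B Bs; pose sig := [:: (1, [:: (0, arg_id)]); (2, [:: (0, arg_id); (1, arg_map)])].
exists (rec_term sig); apply: arr_intro => [|s0' f0 c0 k0 r0]; first exact: rec_term_closed.
apply: arr_intro => // s1 f1 c1 k1 r1; apply: arr_intro => // t tm _ _ [ct tl].
have css : all lclosed [:: s0'; s1] by rewrite /= c0 c1.
apply: (realizes_rec (sig := sig) (ss := [:: s0'; s1])) tl _ => // {ct}.
have crec : lclosed (rec_fix sig [:: s0'; s1]) by apply: rec_fix_closed.
elim/term_ind': tm => [y|i ts IH].
- apply: (realizes_rec_step _ _ css (i := 0) (cs := [:: code_nat y])) => //.
    by rewrite /= code_nat_closed.
  apply: (@realizes_app _ _ natR) r0 _.
  by apply: realizes_arg_id => //; apply: code_realizes.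
- apply: (realizes_rec_step _ _ css (i := 1)
    (cs := [:: code_nat i; code_seq code_term ts])) => //.
    by rewrite /= code_nat_closed code_terms_closed.
  apply: (@realizes_app _ _ Bs B).
    by apply: realizes_app r1 _; apply: realizes_arg_id => //; apply: code_realizes.
  by apply: realizes_arg_map IH => //; [exact: code_term_closed | exact: code_terms_closed].
Qed.

(** * Evaluation depends only on the variables that occur *)

Local Open Scope classical_set_scope.
Local Open Scope fmap_scope.

Lemma eval_agree (M : structure) (s s' : assignment M) t :
  {in term_vars t, forall x, s.[? x] = s'.[? x]} -> eval s t = eval s' t.
Proof.
elim/term_ind': t => [x|i ts IH] /= ss'; first by apply: ss'; rewrite mem_head.
congr (omap _ (oseq _)).
elim: ts IH ss' => //= t ts IH [IHt IHts] ss'; congr (_ :: _).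
- by apply: IHt => x xt; apply: ss'; rewrite mem_cat xt.
- by apply: IH => // x xts; apply: ss'; rewrite mem_cat xts orbT.
Qed.

Lemma evals_agree (M : structure) (s s' : assignment M) ts :
  {in terms_vars ts, forall x, s.[? x] = s'.[? x]} -> evals s ts = evals s' ts.
Proof.
rewrite /evals => ss'; congr oseq; elim: ts ss' => //= t ts IH ss'; congr (_ :: _).
- by apply: eval_agree => x xt; apply: ss'; rewrite /terms_vars /= mem_cat xt.
- by apply: IH => // x xts; apply: ss'; rewrite /terms_vars /= mem_cat xts orbT.
Qed.

Lemma atom_sat_agree (M : structure) (s s' : assignment M) l :
  {in atom_vars l, forall x, s.[? x] = s'.[? x]} -> atom_sat s l -> atom_sat s' l.
Proof.
case: l => [t u|i ts] /= ss' [].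
- move=> a ta ua; exists a; rewrite -(eval_agree (s := s)) // => x xt; apply: ss';
    by rewrite mem_cat xt ?orbT.
- by move=> v sv rv; exists v; rewrite // -(evals_agree (s := s)).
Qed.

(** * From FOT to second-order logic *)

Fixpoint down (n : nat) : seq term := if n is n.+1 then Var n :: down n else [::].

Fixpoint alls (n : nat) (phi : so) : so := if n is n.+1 then SAll n (alls n phi) else phi.

Definition simp (phi psi : so) := SNot (SAnd phi (SNot psi)).
Definition siff (phi psi : so) := SAnd (simp phi psi) (simp psi phi).

Definition row (N i : nat) := SRel i (down N).

(* The team [i.+1] is the team [i] with [x] reset to the value of the variable
   [N], which is not one of the [N] variables of the teams. *)
Definition reset (N x i : nat) : so :=
  alls N (siff (row N i.+1) (SAnd (SAtom (Eq (Var x) (Var N))) (SEx x (row N i)))).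

(** The final [phi] makes up for the missing truth constant when the tuples are empty. *)
Definition eqs (xys : seq (nat * nat)) (phi : so) : so :=
  foldr (fun p => SAnd (SAtom (Eq (Var p.1) (Var p.2)))) phi xys.

(* A team is represented by the relation variable [(i, N)], whose tuples list
   the values of the variables [N.-1], ..., [0]. *)
Fixpoint so_of (N : nat) (phi : fot) (i : nat) : so :=
  match phi with
  | FAtom l => alls N (simp (row N i) (SAtom l))
  | FNeq xys => alls N (SNot (eqs xys (row N i)))
  | FNot phi => SOr (alls N (SNot (row N i))) (SNot (so_of N phi i))
  | FAnd phi psi => SAnd (so_of N phi i) (so_of N psi i)
  | FOr phi psi => SOr (so_of N phi i) (so_of N psi i)
  | FEx x phi => SEx N (SEx2 i.+1 N (SAnd (reset N x i) (so_of N phi i.+1)))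
  | FAll x phi => SAll N (SEx2 i.+1 N (SAnd (reset N x i) (so_of N phi i.+1)))
  | FImp phi psi => SAll2 i.+1 N
      (simp (SAnd (alls N (simp (row N i.+1) (row N i))) (so_of N phi i.+1))
            (so_of N psi i.+1))
  end.

(** Sums in place of maxima: any bound will do, and addition is easy to realize. [fot_bound] also
    counts quantified variables, which must be among the columns of the teams. *)
Fixpoint term_bound (t : term) : nat :=
  match t with
  | Var x => x.+1
  | Fun _ ts => foldr addn 0 (map term_bound ts)
  end.

Definition atom_bound (l : atom) : nat :=
  match l with
  | Eq t u => term_bound t + term_bound u
  | Rel _ ts => foldr (fun t => addn (term_bound t)) 0 ts
  end.

Fixpoint fot_bound (phi : fot) : nat :=
  match phi with
  | FAtom l => atom_bound l
  | FNeq xys => foldr (fun p => addn (p.1.+1 + p.2.+1)) 0 xys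
  | FNot phi => fot_bound phi
  | FAnd phi psi | FOr phi psi | FImp phi psi => fot_bound phi + fot_bound psi
  | FEx x phi | FAll x phi => x.+1 + fot_bound phi
  end.

Definition so_of_fot (phi : fot) : so :=
  SAll2 0 (fot_bound phi) (so_of (fot_bound phi) phi 0).

Lemma term_vars_bound t x : x \in term_vars t -> x < term_bound t.
Proof.
elim/term_ind': t => [y|i ts IH] /=; first by rewrite inE => /eqP->.
elim: ts IH => //= t ts IH [IHt IHts]; rewrite mem_cat => /orP[/IHt|/(IH IHts)]; lia.
Qed.

Lemma terms_vars_bound ts x : x \in terms_vars ts ->
  x < foldr (fun t => addn (term_bound t)) 0 ts.
Proof.
elim: ts => //= t ts IH; rewrite /terms_vars /= mem_cat => /orP[/term_vars_bound|/IH]; lia.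
Qed.

Lemma atom_vars_bound l x : x \in atom_vars l -> x < atom_bound l.
Proof.
case: l => [t u|i ts] /=; last exact: terms_vars_bound.
rewrite mem_cat => /orP[] /term_vars_bound; lia.
Qed.

Lemma fot_fv_bound phi x : x \in fot_fv phi -> x < fot_bound phi.
Proof.
elim: phi => [l|ps|phi IH|phi IH psi IH'|phi IH psi IH'|y phi IH|y phi IH
  |phi IH psi IH'] //=;
  rewrite ?mem_cat ?mem_filter.
- exact: atom_vars_bound.
- elim: ps => //= -[y z] ps IH; rewrite /= !inE.
  case/orP=> /orP[/eqP->|xps]; try lia;
  have := IH; rewrite xps ?orbT => /(_ isT); lia.
- case/orP => [/IH|/IH']; lia.
- case/orP => [/IH|/IH']; lia.
- case/andP => _ /IH; lia.
- case/andP => _ /IH; lia.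
- case/orP => [/IH|/IH']; lia.
Qed.

Lemma mem_terms_vars_down n x : (x \in terms_vars (down n)) = (x < n).
Proof.
elim: n => // n IH; rewrite [terms_vars _]/= inE -/(terms_vars _) IH.
by rewrite ltnS [RHS]leq_eqVlt.
Qed.

Lemma size_down n : size (down n) = n.
Proof. by elim: n => //= n ->. Qed.

Lemma so_fv_alls n phi x : x \in so_fv (alls n phi) -> (n <= x) && (x \in so_fv phi).
Proof.
elim: n => //= n IH; rewrite mem_filter => /andP[xn /IH /andP[nx ->]].
by rewrite andbT ltn_neqAle eq_sym xn.
Qed.

Lemma so_frv_alls n phi : so_frv (alls n phi) = so_frv phi.
Proof. by elim: n. Qed.

Lemma so_fv_eqs xys phi : so_fv (eqs xys phi) =i unzip1 xys ++ unzip2 xys ++ so_fv phi.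
Proof.
move=> x; elim: xys => //= -[y z] ps IH; rewrite /= !inE IH !mem_cat /= !inE !mem_cat.
by case: (x == y); case: (x == z); rewrite ?orbT.
Qed.

Lemma so_frv_eqs xys phi : so_frv (eqs xys phi) = so_frv phi.
Proof. by elim: xys. Qed.

(** Variables below [N] are bound by [alls], and the only other one, [N], by the quantifier around
    [reset]. *)
Lemma so_fv_so_of N phi i : fot_bound phi <= N -> so_fv (so_of N phi i) =i pred0.
Proof.
have row_fv j x : x \in so_fv (row N j) = (x < N) by rewrite /= mem_terms_vars_down.
have reset_fv y j x : y < N -> x \in so_fv (reset N y j) -> x = N.
  move=> yN /so_fv_alls /andP[Nx] /=.
  rewrite !(mem_cat, inE, mem_filter, mem_terms_vars_down).
  have xN : x < N = false by rewrite ltnNge Nx.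
  have xy : x == y = false by apply/eqP; lia.
  by rewrite xN xy /= ?andbF ?orbF; case/orP => /eqP.
elim: phi i => [l|ps|phi IH|phi IH psi IH'|phi IH psi IH'|y phi IH|y phi IH
  |phi IH psi IH'] i
  bd x; apply/negbTE/negP => /=; rewrite ?mem_cat ?mem_filter.
- move=> /so_fv_alls /andP[Nx]; rewrite /= mem_cat mem_terms_vars_down.
  by case/orP => [|/atom_vars_bound]; move: bd => /=; lia.
- move=> /so_fv_alls /andP[Nx]; rewrite /= so_fv_eqs catA mem_cat /= mem_terms_vars_down.
  by case/orP => [/(@fot_fv_bound (FNeq ps))|]; move: bd => /=; lia.
- case/orP=> [/so_fv_alls /andP[Nx]|]; last by rewrite IH.
  rewrite /= mem_terms_vars_down; lia.
- by rewrite IH ?IH' //=; move: bd => /=; lia.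
- by rewrite IH ?IH' //=; move: bd => /=; lia.
- case/andP => /eqP xN; rewrite mem_cat IH ?orbF; last by move: bd => /=; lia.
  by move/reset_fv => xN'; apply/xN/xN'; move: bd => /=; lia.
- case/andP => /eqP xN; rewrite mem_cat IH ?orbF; last by move: bd => /=; lia.
  by move/reset_fv => xN'; apply/xN/xN'; move: bd => /=; lia.
- rewrite IH ?IH' ?orbF //=; try by move: bd => /=; lia.
  move/so_fv_alls => /andP[Nx]; rewrite /= mem_cat mem_terms_vars_down; lia.
Qed.

(** A clause mentions only the team [i] that it is given and the team [i.+1] that it binds, so the
    depth can serve as the index. *)
Lemma so_frv_so_of N phi i v : v \in so_frv (so_of N phi i) -> v = (i, N).
Proof.
have row_frv j : so_frv (row N j) = [:: (j, N)] by rewrite /= size_down.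
have reset_frv y j : v \in so_frv (siff (row N j.+1)
    (SAnd (SAtom (Eq (Var y) (Var N))) (SEx y (row N j)))) -> v = (j, N) \/ v = (j.+1, N).
  by rewrite /= size_down !inE; do ?case/orP; move/eqP; auto.
elim: phi i => [l|ps|phi IH|phi IH psi IH'|phi IH psi IH'|y phi IH|y phi IH
  |phi IH psi IH'] i;
  rewrite [so_frv _]/= ?mem_cat ?mem_filter ?so_frv_alls.
- by rewrite /= size_down ?orbF inE => /eqP.
- by rewrite /= so_frv_eqs row_frv inE => /eqP.
- by rewrite /= size_down inE => /orP[/eqP|/IH].
- by case/orP => [/IH|/IH'].
- by case/orP => [/IH|/IH'].
- by case/andP=> /eqP ni; rewrite mem_cat => /orP[/reset_frv []|/IH].
- by case/andP=> /eqP ni; rewrite mem_cat => /orP[/reset_frv []|/IH].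
- case/andP=> /eqP ni; rewrite !mem_cat ?so_frv_alls /= size_down !inE.
  by case/orP => [/orP[/orP[/eqP|/eqP]|/IH]|/IH'].
Qed.

Lemma so_of_fot_closed phi : closed_so (so_of_fot phi).
Proof.
apply/andP; split; apply/nilP.
  have := so_fv_so_of 0 (leqnn (fot_bound phi)); rewrite /so_of_fot /=.
  by case: (so_fv _) => // x s /(_ x); rewrite !inE eqxx.
rewrite /so_of_fot /=.
have : {subset so_frv (so_of (fot_bound phi) phi 0) <= pred1 (0, fot_bound phi)}.
  by move=> v /so_frv_so_of ->; rewrite inE.
elim: (so_frv _) => //= v s IH sub; have := sub v; rewrite mem_head => /(_ isT).
by rewrite inE => ->; apply: IH => w ws; apply: sub; rewrite inE ws orbT.
Qed.

(** * Teams simulated by relations *)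

Section Simulation.
Variables (M : structure) (N : nat).
Implicit Types (s t : assignment M) (r : rel_assignment M) (X Y : set (assignment M)).

Definition agree (V : seq var) s t := {in V, forall x, s.[? x] = t.[? x]}.

Lemma fnd_upd s (x y : nat) a : s.[x <- a].[? y] = if y == x then Some a else s.[? y].
Proof. exact: fnd_set. Qed.

Lemma sub_agree V W s t : {subset V <= W} -> agree W s t -> agree V s t.
Proof. by move=> VW st x /VW /st. Qed.

Lemma alls_sat s r n phi :
  so_sat s r (alls n phi) <->
  forall s', (forall x, n <= x -> s'.[? x] = s.[? x]) ->
             (forall x, x < n -> s'.[? x]) -> so_sat s' r phi.
Proof.
elim: n s => [|n IH] s /=; split.
- move=> sat s' ss' _; suff -> : s' = s by [].
  by apply/fmapP => x; apply: ss'.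
- by apply.
- move=> sat s' above below; have := below n (leqnn _).
  case s'n: s'.[? n] => [a|] // _; apply: (proj1 (IH _) (sat a)) => x nx.
    rewrite fnd_upd; case: ifP => [/eqP -> //|xn]; apply: above; lia.
  by apply: below; lia.
- move=> sat a; apply/IH => s' above below; apply: sat => x nx.
    rewrite above ?fnd_upd; last lia.
    by case: ifP => // /eqP; lia.
  case: (ltngtP x n) => [/below//|xn|->]; first by lia.
  by rewrite above // fnd_upd eqxx.
Qed.

Lemma mix_exists n s t : (forall x, x < n -> t.[? x]) ->
  exists s', (forall x, x < n -> s'.[? x] = t.[? x]) /\
             (forall x, n <= x -> s'.[? x] = s.[? x]).
Proof.
elim: n => [|n IH] def; first by exists s.
have [x xn|s' [below above]] := IH; first by apply: def; lia.
case tn: t.[? n] (def n (leqnn _)) => [a|] // _.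
exists s'.[n <- a]; split=> x xn; rewrite fnd_upd; case: ifP => [/eqP|] xn'.
- by rewrite xn' tn.
- by apply: below; lia.
- by lia.
- by apply: above; lia.
Qed.

(** A member of a team may be undefined on some columns, a row of a relation may not; the gaps are
    filled with an arbitrary element. *)
Lemma total_exists n t : exists s, (forall x, x < n -> s.[? x]) /\
  forall x, x < n -> t.[? x] -> s.[? x] = t.[? x].
Proof.
have [a] := dom_nonempty M.
elim: n => [|n [s [def st]]]; first by exists t.
exists s.[n <- odflt a t.[? n]]; split=> x xn; rewrite fnd_upd; case: ifP => [/eqP|] xn'.
- by [].
- by apply: def; lia.
- by rewrite xn'; case: (t.[? n]).
- by apply: st; lia.
Qed.

Lemma evals_cons s u us : evals s (u :: us) =
  obind (fun a => omap (cons a) (evals s us)) (eval s u).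
Proof. by []. Qed.

Lemma size_evals s ts v : evals s ts = Some v -> size v = size ts.
Proof.
elim: ts v => [|u us IH] v; first by case=> <-.
rewrite evals_cons; case: (eval s u) => //= a.
by case E: (evals s us) => [w|] //= [<-] /=; rewrite (IH _ E).
Qed.

Lemma evals_down s n : (forall x, x < n -> s.[? x]) -> exists v, evals s (down n) = Some v.
Proof.
elim: n => [|n IH] def; first by exists [::].
have [x xn|v sv] := IH; first by apply: def; lia.
rewrite evals_cons /= sv; case: (s.[? n]) (def n (leqnn _)) => //= a _.
by exists (a :: v).
Qed.

Lemma evals_down_def s n v : evals s (down n) = Some v -> forall x, x < n -> s.[? x].
Proof.
elim: n v => [|n IH] v //; rewrite evals_cons /=.
case sn: (s.[? n]) => [a|] //=; case sv: (evals s (down n)) => [w|] //= _ x.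
by rewrite ltnS leq_eqVlt => /orP[/eqP->|/(IH _ sv)//]; rewrite sn.
Qed.

Lemma evals_down_inj s t n v : evals s (down n) = Some v -> evals t (down n) = Some v ->
  forall x, x < n -> s.[? x] = t.[? x].
Proof.
elim: n v => [|n IH] v //; rewrite !evals_cons /=.
case sn: (s.[? n]) => [a|] //=; case sv: (evals s (down n)) => [w|] //= [<-].
case tn: (t.[? n]) => [b|] //=; case tv: (evals t (down n)) => [w'|] //= [ba ww'] x.
rewrite ltnS leq_eqVlt => /orP[/eqP->|xn]; first by rewrite sn tn ba.
by apply: IH xn; rewrite ?sv ?tv ?ww'.
Qed.

Lemma evals_down_eq s t n : (forall x, x < n -> s.[? x] = t.[? x]) ->
  evals s (down n) = evals t (down n).
Proof. by move=> st; apply: evals_agree => x; rewrite mem_terms_vars_down => /st. Qed.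

Definition rel_of (C : assignment M -> Prop) : seq M -> Prop :=
  fun v => exists2 s, evals s (down N) = Some v & C s.

Lemma row_upd s r i P : so_sat s (rel_upd r i N P) (row N i) <->
  exists2 v, evals s (down N) = Some v & P v.
Proof.
rewrite /= /rel_upd; split=> -[v sv Pv]; exists v => //;
  by move: Pv; rewrite (size_evals sv) size_down eqxx.
Qed.

Lemma row_upd_neq s r i j P : j <> i ->
  so_sat s (rel_upd r i N P) (row N j) <-> so_sat s r (row N j).
Proof.
move=> /eqP/negbTE ji; rewrite /= /rel_upd; split=> -[v sv Pv]; exists v => //;
  by move: Pv; rewrite xpair_eqE ji.
Qed.

Lemma row_rel_of (C : assignment M -> Prop) s r i :
  (forall s t, (forall x, x < N -> s.[? x] = t.[? x]) -> C s -> C t) ->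
  so_sat s (rel_upd r i N (rel_of C)) (row N i) <->
  (forall x, x < N -> s.[? x]) /\ C s.
Proof.
move=> ext; rewrite row_upd; split.
  move=> [v sv [t tv Ct]]; split; first exact: evals_down_def sv.
  exact: ext (evals_down_inj tv sv) Ct.
by move=> [/evals_down[v sv] Cs]; exists v => //; exists s.
Qed.

Lemma row_agree s t r i : (forall x, x < N -> s.[? x] = t.[? x]) ->
  so_sat s r (row N i) -> so_sat t r (row N i).
Proof. by move=> st [v sv rv]; exists v; rewrite // -(evals_down_eq st). Qed.

Lemma row_def s r i : so_sat s r (row N i) -> forall x, x < N -> s.[? x].
Proof. by move=> [v /evals_down_def]. Qed.

(** [alls] reaches only the assignments that agree with [s] from [N] on. Any other row is moved
    there by [mix_exists] without changing its columns, on which alone [Q] depends. *)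
Lemma alls_row_sat s r i (Q : assignment M -> Prop) phi :
  (forall s t, (forall x, x < N -> s.[? x] = t.[? x]) -> Q s -> Q t) ->
  (forall s, so_sat s r phi <-> (so_sat s r (row N i) -> Q s)) ->
  so_sat s r (alls N phi) <-> forall s', so_sat s' r (row N i) -> Q s'.
Proof.
move=> extQ phiE; rewrite alls_sat; split=> [sat s' rs'|sat s' _ _].
  2: by apply/phiE; apply: sat.
have [s'' [below above]] := mix_exists s (row_def rs').
apply: (extQ _ _ below); apply: (proj1 (phiE s'')); last first.
  by apply: row_agree rs' => x xN; rewrite below.
by apply: sat => // x xN; rewrite below //; apply: row_def rs' x xN.
Qed.

(** A two-way matching up to the values on [V], not an equality: team domains and columns outside
    the free variables may differ. *)
Definition sim (V : seq var) X r i :=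
  (forall t, X t -> exists2 s, so_sat s r (row N i) & agree V t s) /\
  (forall s, so_sat s r (row N i) -> exists2 t, X t & agree V t s).

Lemma sub_sim V W X r i : {subset V <= W} -> sim W X r i -> sim V X r i.
Proof.
move=> VW [XR RX]; split=> [t /XR[s rs ts]|s /RX[t Xt ts]].
- by exists s => //; apply: sub_agree ts.
- by exists t => //; apply: sub_agree ts.
Qed.

Lemma simp_sat s r phi psi :
  so_sat s r (simp phi psi) <-> (so_sat s r phi -> so_sat s r psi).
Proof.
rewrite /=; split=> [nand phis|imp [phis npsi]]; last exact/npsi/imp.
by apply: contrapT => npsi; apply: nand.
Qed.

Lemma SAll2_sat s r i n phi :
  so_sat s r (SAll2 i n phi) <-> forall P, so_sat s (rel_upd r i n P) phi.
Proof. by []. Qed.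

Lemma siff_sat s r phi psi :
  so_sat s r (siff phi psi) <-> (so_sat s r phi <-> so_sat s r psi).
Proof.
rewrite -[so_sat s r (siff _ _)]/(so_sat s r (simp phi psi) /\ so_sat s r (simp psi phi)).
by rewrite !simp_sat.
Qed.

Lemma eqs_sat s r xys phi : so_sat s r (eqs xys phi) <->
  (forall p, p \in xys -> exists2 a, s.[? p.1] = Some a & s.[? p.2] = Some a) /\
  so_sat s r phi.
Proof.
elim: xys => [|q xys IH] /=; first by split=> [|[]].
rewrite IH; split=> [[qa [pa ?]]|[pa ?]]; split=> //.
- by move=> p; rewrite inE => /orP[/eqP->//|/pa].
- by apply: pa; rewrite mem_head.
- by split=> // p pq; apply: pa; rewrite inE pq orbT.
Qed.

Lemma neq_tuplesP s xys : (forall p, p \in xys -> s.[? p.1]) ->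
  [seq s.[? x] | x <- unzip1 xys] = [seq s.[? y] | y <- unzip2 xys] <->
  forall p, p \in xys -> exists2 a, s.[? p.1] = Some a & s.[? p.2] = Some a.
Proof.
elim: xys => [|q xys IH] def //=.
have {}IH := IH (fun p pq => def p (mem_behead (s := _ :: _) pq)).
split=> [[q12 /IH eqxys] p|eqs].
- rewrite inE => /orP[/eqP->|/eqxys//]; rewrite -q12.
  by case E: (s.[? q.1]) (def q (mem_head _ _)) => [a|] // _; exists a.
- have [a -> ->] := eqs q (mem_head _ _); congr (_ :: _); apply/IH => p pq.
  by apply: eqs; rewrite inE pq orbT.
Qed.

Definition reset_cond r i x a s :=
  s.[? x] = Some a /\ exists b, so_sat s.[x <- b] r (row N i).

Lemma upd_agree s t x b : (forall y, y < N -> s.[? y] = t.[? y]) ->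
  forall y, y < N -> s.[x <- b].[? y] = t.[x <- b].[? y].
Proof. by move=> st y yN; rewrite !fnd_upd st. Qed.

Lemma reset_cond_agree r i x a s t : x < N -> (forall y, y < N -> s.[? y] = t.[? y]) ->
  reset_cond r i x a s -> reset_cond r i x a t.
Proof.
move=> xN st [sx [b rs]]; split; first by rewrite -st.
by exists b; apply: row_agree rs; apply: upd_agree.
Qed.

(** The quantifiers of [reset] bind variables below [N] only, so the value [a] stored at [N]
    survives them. *)
Lemma reset_sat s r i x a P : x < N ->
  so_sat s.[N <- a] (rel_upd r i.+1 N P) (reset N x i) <->
  forall s', (forall y, y < N -> s'.[? y]) ->
    so_sat s' (rel_upd r i.+1 N P) (row N i.+1) <-> reset_cond r i x a s'.
Proof.
move=> xN; set r' := rel_upd _ _ _ _.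
have bodyE s' : s'.[? N] = Some a ->
    so_sat s' r' (siff (row N i.+1) (SAnd (SAtom (Eq (Var x) (Var N))) (SEx x (row N i))))
    <-> (so_sat s' r' (row N i.+1) <-> reset_cond r i x a s').
  move=> s'N; rewrite siff_sat.
  suff -> : so_sat s' r' (SAnd (SAtom (Eq (Var x) (Var N))) (SEx x (row N i))) <->
            reset_cond r i x a s' by [].
  have rowE b : so_sat s'.[x <- b] r' (row N i) <-> so_sat s'.[x <- b] r (row N i).
    by apply: row_upd_neq; lia.
  split=> [[[c /= xc]]|[xa [b /rowE rb]]].
    by rewrite s'N => -[->] [b /rowE rb]; split=> //; exists b.
  by split; [exists a | exists b].
rewrite alls_sat; split=> [sat s' def|sat s' above below].
- have [s'' [below above]] := mix_exists s.[N <- a] def.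
  have s''N : s''.[? N] = Some a by rewrite above // fnd_upd eqxx.
  have def'' y : y < N -> s''.[? y] by move=> yN; rewrite below // def.
  have below' y : y < N -> s'.[? y] = s''.[? y] by move=> yN; rewrite below.
  have [to fro] := proj1 (bodyE _ s''N) (sat _ above def'').
  split=> H.
    by apply: (reset_cond_agree xN below); apply/to/(row_agree below').
  by apply: (row_agree below); apply/fro/(reset_cond_agree xN below').
- by apply/bodyE; [rewrite above // fnd_upd eqxx | apply: sat].
Qed.

Lemma reset_exists s r i x a : x < N ->
  exists P, so_sat s.[N <- a] (rel_upd r i.+1 N P) (reset N x i).
Proof.
move=> xN; exists (rel_of (reset_cond r i x a)); apply/reset_sat => // s' def.
by rewrite row_rel_of => [|s1 s2]; [split=> [[]|] | apply: reset_cond_agree].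
Qed.

Lemma sim_reset V X s r i x a P : x < N -> {in V, forall y, y < N} ->
  sim [seq y <- V | y != x] X r i ->
  so_sat s.[N <- a] (rel_upd r i.+1 N P) (reset N x i) ->
  sim V (team_upd X x a) (rel_upd r i.+1 N P) i.+1.
Proof.
move=> xN VN [XR RX] /(reset_sat _ _ _ _ _ xN) satE.
have Vx y : y \in V -> y != x -> y \in [seq y <- V | y != x].
  by move=> yV yx; rewrite mem_filter yx.
split.
- move=> _ [t /XR[s0 rs0 ts0] <-].
  have def0 := row_def rs0.
  have def y : y < N -> s0.[x <- a].[? y].
    by move=> yN; rewrite fnd_upd; case: ifP => // _; apply: def0.
  exists s0.[x <- a]; last first.
    by move=> y yV; rewrite !fnd_upd; case: ifP => // /negbT yx; apply: ts0; apply: Vx.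
  apply/satE => //; split; first by rewrite fnd_upd eqxx.
  (* The old value of [x] is the witness: putting it back restores the row [s0]. *)
  case s0x: s0.[? x] (def0 _ xN) => [b|] // _; exists b.
  apply: row_agree rs0 => y yN; rewrite !fnd_upd; case: (y =P x) => // ->.
  by rewrite s0x.
- move=> s' rs'; have /satE[/(_ rs')[s'x [b /RX[t Xt ts']]] _] := row_def rs'.
  exists t.[x <- a]; first by exists t.
  move=> y yV; rewrite fnd_upd; case: ifP => [/eqP->//|/negbT yx].
  by rewrite ts' ?Vx // fnd_upd (negbTE yx).
Qed.

Lemma so_of_sat phi i X s r : fot_bound phi <= N -> sim (fot_fv phi) X r i ->
  fot_sat X phi <-> so_sat s r (so_of N phi i).
Proof.
elim: phi i X s r => [l|xys|phi IH|phi IH psi IH'|phi IH psi IH'|x phi IH|x phi IH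
  |phi IH psi IH']
  i X s r bd XR; rewrite [so_of _ _ _]/= [fot_sat _ _]/=.
- have lt x : x \in atom_vars l -> x < N by move=> /atom_vars_bound; move: bd => /=; lia.
  rewrite (@alls_row_sat s r i (fun s => atom_sat s l)); last first.
  + by move=> s'; rewrite simp_sat.
  + by move=> s1 s2 s12; apply: atom_sat_agree => x /lt /s12.
  case: XR => XR RX; split=> sat.
    by move=> s' /RX[t /sat tl ts]; apply: atom_sat_agree tl.
  by move=> t /XR[s' /sat sl ts]; apply: atom_sat_agree sl => x xl; rewrite ts.
- set Q := fun s : assignment M =>
    [seq s.[? x] | x <- unzip1 xys] <> [seq s.[? y] | y <- unzip2 xys].
  have agreeQ s1 s2 : {in fot_fv (FNeq xys), forall x, s1.[? x] = s2.[? x]} -> Q s1 -> Q s2.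
    move=> s12; rewrite /Q.
    rewrite -!(eq_in_map (fun x => s1.[? x]) (fun x => s2.[? x]) _).1 // => x xV;
      by apply: s12; rewrite /= mem_cat xV ?orbT.
  have lt x : x \in fot_fv (FNeq xys) -> x < N by move=> /fot_fv_bound; lia.
  rewrite (@alls_row_sat s r i Q); last first.
  + move=> s'; rewrite -[so_sat s' r (SNot _)]/(~ so_sat s' r (eqs _ _)) eqs_sat.
    split=> [nand rs'|nQ [eqxys rs']].
      rewrite /Q neq_tuplesP; first by move=> eqxys; apply: nand.
      move=> p pq; apply: (row_def rs'); apply: lt.
      by rewrite /= mem_cat (map_f fst pq).
    apply: nQ rs' _; apply/neq_tuplesP => // p /eqxys[a -> _] //.
  + by move=> s1 s2 s12; apply: agreeQ => x /lt /s12.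
  case: XR => XR RX; split=> sat.
    by move=> s' /RX[t /sat tl ts]; apply: agreeQ tl.
  by move=> t /XR[s' /sat sl ts]; apply: agreeQ sl => x xl; rewrite ts.
- rewrite [so_sat _ _ _]/= -(IH i X s r bd XR) (@alls_row_sat s r i (fun=> False)) //.
  case: XR => XR RX; split=> -[H|]; [left|by right|left|by right].
    by move=> s' /RX[t]; rewrite H.
  by apply/seteqP; split=> // t /XR[s' /H].
- move: bd => /= bd; rewrite [so_sat _ _ _]/=.
  rewrite -(IH i X s r) -?(IH' i X s r) //; try lia;
    apply: sub_sim XR => x xV; by rewrite /= mem_cat xV ?orbT.
- move: bd => /= bd; rewrite [so_sat _ _ _]/=.
  rewrite -(IH i X s r) -?(IH' i X s r) //; try lia;
    apply: sub_sim XR => x xV; by rewrite /= mem_cat xV ?orbT.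
- have xN : x < N by move: bd => /=; lia.
  have bd' : fot_bound phi <= N by move: bd => /=; lia.
  have VN : {in fot_fv phi, forall y, y < N} by move=> y /fot_fv_bound; lia.
  split=> [[a sat]|[a [P [res sat]]]]; exists a.
    have [P res] := reset_exists s r i a xN; exists P; split=> //.
    by apply/(IH _ _ s.[N <- a] _ bd' (sim_reset xN VN XR res)).
  by apply/(IH _ _ s.[N <- a] _ bd' (sim_reset xN VN XR res)).
- have xN : x < N by move: bd => /=; lia.
  have bd' : fot_bound phi <= N by move: bd => /=; lia.
  have VN : {in fot_fv phi, forall y, y < N} by move=> y /fot_fv_bound; lia.
  split=> sat a.
    have [P res] := reset_exists s r i a xN; exists P; split=> //.
    by apply/(IH _ _ s.[N <- a] _ bd' (sim_reset xN VN XR res)).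
  have [P [res {}sat]] := sat a.
  by apply/(IH _ _ s.[N <- a] _ bd' (sim_reset xN VN XR res)).
- have bd1 : fot_bound phi <= N by move: bd => /=; lia.
  have bd2 : fot_bound psi <= N by move: bd => /=; lia.
  have V1 : {subset fot_fv phi <= fot_fv (FImp phi psi)}.
    by move=> x xV; rewrite /= mem_cat xV.
  have V2 : {subset fot_fv psi <= fot_fv (FImp phi psi)}.
    by move=> x xV; rewrite /= mem_cat xV orbT.
  have lt x : x \in fot_fv (FImp phi psi) -> x < N by move=> /fot_fv_bound; lia.
  have subE P : let r' := rel_upd r i.+1 N P in
      so_sat s r' (alls N (simp (row N i.+1) (row N i))) <->
      forall s', so_sat s' r' (row N i.+1) -> so_sat s' r (row N i).
    move=> r'; apply: alls_row_sat => [s1 s2|s1]; first exact: row_agree.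
    by rewrite simp_sat [so_sat s1 r' (row N i)]row_upd_neq //; lia.
  rewrite SAll2_sat.
  case: (XR) => XR1 RX1; split=> [imp P|imp Y YX].
    rewrite simp_sat => -[/subE sub satphi].
    (* The subrelation [P] becomes the set of members of [X] with a partner in [P]. *)
    pose Y := [set t | X t /\ exists2 s', so_sat s' (rel_upd r i.+1 N P) (row N i.+1) &
                                agree (fot_fv (FImp phi psi)) t s'].
    have YR : sim (fot_fv (FImp phi psi)) Y (rel_upd r i.+1 N P) i.+1.
      split=> [t [_]|s' rs'] //; have [t Xt ts] := RX1 _ (sub _ rs').
      by exists t => //; split=> //; exists s'.
    apply/(IH' _ Y s _ bd2 (sub_sim V2 YR)); apply: imp => [t []//|].
    by apply/(IH _ Y s _ bd1 (sub_sim V1 YR)).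
  (* Conversely, the subteam [Y] becomes the rows of the team [i] with a partner in [Y]; keeping to
     these rows makes it a subrelation. *)
  pose C s' := so_sat s' r (row N i) /\
    exists2 t, Y t & agree (fot_fv (FImp phi psi)) t s'.
  have extC s1 s2 : (forall x, x < N -> s1.[? x] = s2.[? x]) -> C s1 -> C s2.
    move=> s12 [rs1 [t Yt ts]]; split; first exact: row_agree rs1.
    by exists t => // x xV; rewrite ts ?s12 ?lt.
  have YR : sim (fot_fv (FImp phi psi)) Y (rel_upd r i.+1 N (rel_of C)) i.+1.
    split=> [t Yt|s']; last by rewrite row_rel_of // => -[_ []].
    have [s' rs' ts] := XR1 _ (YX _ Yt); exists s' => //; rewrite row_rel_of //.
    by split; [apply: row_def rs' | split=> //; exists t].
  move=> /(IH _ Y s _ bd1 (sub_sim V1 YR)) satphi.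
  apply/(IH' _ Y s _ bd2 (sub_sim V2 YR)).
  have := imp (rel_of C); rewrite simp_sat; apply; split=> //.
  by apply/subE => s'; rewrite row_rel_of // => -[_ []].
Qed.
End Simulation.

Definition sentence_of_fot (phi : fot) : so_sentence :=
  exist _ (so_of_fot phi) (so_of_fot_closed phi).

Lemma sentence_of_fot_valid phi : so_valid (sentence_of_fot phi) <-> fot_valid phi.
Proof.
set N := fot_bound phi; split=> valid M.
- move=> D X VD XD.
  pose C s := exists2 t, X t & agree (fot_fv phi) t s.
  have extC (s1 s2 : assignment M) :
      (forall x, x < N -> s1.[? x] = s2.[? x]) -> C s1 -> C s2.
    by move=> s12 [t Xt ts]; exists t => // x xV; rewrite ts ?s12 ?fot_fv_bound.
  pose r : rel_assignment M := fun _ _ => True.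
  have := valid M [fmap] r (rel_of N C).
  suff XR : sim N (fot_fv phi) X (rel_upd r 0 N (rel_of N C)) 0.
    by move=> sat; apply/(so_of_sat [fmap] (leqnn N) XR).
  split=> [t Xt|s]; last by rewrite row_rel_of // => -[].
  have [s [def st]] := total_exists N t; exists s; last first.
    move=> x xV; rewrite st ?fot_fv_bound //.
    by case: fndP => //; rewrite (XD _ Xt) VD.
  apply/row_rel_of => //; split=> //; exists t => // x xV.
  rewrite st ?fot_fv_bound //.
  by case: fndP => //; rewrite (XD _ Xt) VD.
- move=> s r; move=> P; set r' := rel_upd r 0 N P.
  pose D := [fset x | x in iota 0 N]%fset.
  have DN x : (x \in D) = (x < N) by rewrite !inE /= mem_iota.
  (* Rows come from assignments with arbitrary domains, but a team needs a common one: they are cut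
     down to the [N] columns. *)
  pose X := [set s'.[& D] | s' in [set s' | so_sat s' r' (row N 0)]].
  have XR : sim N (fot_fv phi) X r' 0.
    split=> [_ [s' rs' <-]|s' rs']; [exists s' => //|exists s'.[& D]; first by exists s'];
    by move=> x xV; rewrite fnd_restrict DN fot_fv_bound.
  apply/(so_of_sat s (leqnn N) XR)/(valid M D X) => [x xV|_ [s' rs' <-]].
    by rewrite DN fot_fv_bound.
  rewrite domf_restrict; apply/fsetIidPl/fsubsetP => x.
  by rewrite DN -fndSome => /(row_def rs').
Qed.

(** * From second-order logic to FOT *)

(* Reserved symbols (index, arity): the constants (0, 0) and (1, 0), the pairing
   function (0, 2) with its projections (0, 1) and (1, 1), and the map (2, 1)
   onto the copy of the original structure.  The function symbols of the source
   formula are shifted by 3.  The variable 0 carries the team, 1 is auxiliary,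
   and the variable [x] of the source formula becomes [x.+2]; the variable 2
   is also bound in [good]. *)
Definition cst (b : bool) : term := Fun b [::].
Definition pair_term (t u : term) : term := Fun 0 [:: t; u].
Definition tag (b : bool) (t : term) : term := pair_term (cst b) t.
(** The level is written in unary and ended by [tag false], so every key beyond level [d] has the
    form [iter d.+1 (tag true) u], and one quantifier over [u] reaches them all. *)
Definition key (d : nat) (t : term) : term := iter d (tag true) (tag false t).
Definition tuple_term (ts : seq term) : term := foldr pair_term (cst false) ts.

(** The map (2, 1) sends every value of a variable or a function into the copy of the source
    structure. *)
Fixpoint tr (t : term) : term :=
  match t with
  | Var x => Fun 2 [:: Var x.+2]
  | Fun i ts => Fun 2 [:: Fun i.+3 (map tr ts)]
  end.

Definition tr_atom (l : atom) : atom :=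
  match l with
  | Eq t u => Eq (tr t) (tr u)
  | Rel i ts => Rel i (map tr ts)
  end.

(** In a nonempty team the negated inequality says that some assignment has equal values at 0 and 1;
    the equation makes [u] constant, with the value of 1. *)
Definition mem_team (u : term) : fot :=
  FEx 1 (FAnd (FAtom (Eq (Var 1) u)) (FNot (FNeq [:: (0, 1)]))).

Definition good (d : nat) : fot :=
  FAll 2 (FAnd (FOr (mem_team (tag false (Var 2))) (mem_team (tag true (Var 2))))
    (FAnd (FNot (FAnd (mem_team (tag false (key d (Var 2))))
                      (mem_team (tag true (key d (Var 2))))))
          (FAnd (mem_team (tag false (iter d.+1 (tag true) (Var 2))))
                (mem_team (tag true (iter d.+1 (tag true) (Var 2))))))).

Definition upd (e : nat -> nat -> nat) (i n d : nat) : nat -> nat -> nat :=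
  fun j m => if (j == i) && (m == n) then d else e j m.

(** The argument [e] gives the level at which a relation variable is stored. Subteams are only
    quantified universally, so [SEx2] is the dual of [SAll2]. *)
Fixpoint fot_of (phi : so) (d : nat) (e : nat -> nat -> nat) : fot :=
  match phi with
  | SAtom l => FAtom (tr_atom l)
  | SRel i ts => mem_team (tag true (key (e i (size ts)) (tuple_term (map tr ts))))
  | SNot phi => FNot (fot_of phi d e)
  | SAnd phi psi => FAnd (fot_of phi d e) (fot_of psi d e)
  | SOr phi psi => FOr (fot_of phi d e) (fot_of psi d e)
  | SEx x phi => FEx x.+2 (fot_of phi d e)
  | SAll x phi => FAll x.+2 (fot_of phi d e)
  | SEx2 i n phi => FNot (FImp (good d) (FNot (fot_of phi d.+1 (upd e i n d))))
  | SAll2 i n phi => FImp (good d) (fot_of phi d.+1 (upd e i n d))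
  end.

(** The last conjunct constrains the team: the variable 0 takes every value, so that each key starts
    with both bits. *)
Definition axioms : fot :=
  FAnd (FNot (FAtom (Eq (cst false) (cst true))))
 (FAnd (FAll 1 (FAll 2
         (FAnd (FAtom (Eq (Fun 0 [:: pair_term (Var 1) (Var 2)]) (Var 1)))
               (FAtom (Eq (Fun 1 [:: pair_term (Var 1) (Var 2)]) (Var 2))))))
       (FAll 1 (FNot (FNeq [:: (0, 1)])))).

(** A disjunction evaluates both parts in the same full team, whereas [FImp] would pass to
    subteams. *)
Definition fot_of_so (phi : so) : fot :=
  FOr (FNot axioms) (fot_of phi 0 (fun _ _ => 0)).

(** * Values stored in a team *)

Section Coding.
Variable K : structure.
Implicit Types (X Y : set (assignment K)) (t : assignment K) (a e : K).

Definition kcst (b : bool) : K := funI b [::].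
Definition kpair a e : K := funI 0 [:: a; e].
Definition ktag b e := kpair (kcst b) e.
Definition kkey d e := iter d (ktag true) (ktag false e).
Definition ktuple (v : seq K) : K := foldr kpair (kcst false) v.

Lemma eval_tag t b u a : eval t u = Some a -> eval t (tag b u) = Some (ktag b a).
Proof. by move=> /= ->. Qed.

Lemma eval_tags t d u a : eval t u = Some a ->
  eval t (iter d (tag true) u) = Some (iter d (ktag true) a).
Proof. by move=> ua; elim: d => // d IH; rewrite !iterS; apply: eval_tag. Qed.

Lemma eval_key t d u a : eval t u = Some a -> eval t (key d u) = Some (kkey d a).
Proof. by move=> ua; apply/eval_tags/eval_tag. Qed.

Lemma eval_tuple t us v : evals t us = Some v -> eval t (tuple_term us) = Some (ktuple v).
Proof.
elim: us v => [|u us IH] v; first by case=> <-.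
rewrite evals_cons; case E: (eval t u) => [a|] //=.
by case E': (evals t us) => [w|] //= [<-]; rewrite E (IH _ E').
Qed.

Definition codes X a := exists2 t, X t & t.[? 0] = Some a.

Lemma team_upd_neq0 X x a : X <> set0 -> team_upd X x a <> set0.
Proof.
move=> X0 XU; apply: X0; apply/seteqP; split=> // t Xt.
have : team_upd X x a t.[x <- a] by exists t.
by rewrite XU.
Qed.

Lemma codes_upd X x a e : codes (team_upd X x.+1 a) e <-> codes X e.
Proof.
split=> [[_ [t Xt <-]]|[t Xt te]].
  by rewrite fnd_upd => te; exists t.
by exists t.[x.+1 <- a]; [exists t | rewrite fnd_upd].
Qed.

Lemma neq0_mem X : X <> set0 -> exists t, X t.
Proof. by move/eqP/set0P. Qed.

Lemma mem_team_sat X u e : X <> set0 ->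
  (forall t a, X t -> eval t.[1 <- a] u = Some e) -> fot_sat X (mem_team u) <-> codes X e.
Proof.
move=> X0 ue; have [t0 Xt0] := neq0_mem X0; split.
- move=> [a [/(_ t0.[1 <- a])]] []; first by exists t0.
  move=> c /=; rewrite fnd_upd ue //= => -[<-] [<-] [/team_upd_neq0 //|].
  move/existsNP => [_ /not_implyP [[t Xt <-]]] /contrapT [].
  by rewrite !fnd_upd /= => te; exists t.
- move=> [t Xt te]; exists e; split.
    by move=> _ [t' Xt' <-]; exists e; rewrite ?ue //= fnd_upd.
  right=> /(_ t.[1 <- e]); apply; first by exists t.
  by rewrite /= !fnd_upd te.
Qed.

Definition is_good d X := forall e,
  [/\ exists b, codes X (ktag b e),
      ~ (codes X (ktag false (kkey d e)) /\ codes X (ktag true (kkey d e))) &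
      forall b, codes X (ktag b (iter d.+1 (ktag true) e))].

Lemma good_sat X d : X <> set0 -> fot_sat X (good d) <-> is_good d X.
Proof.
move=> X0.
have memE e u a : (forall t, t.[? 2] = Some e -> eval t u = Some a) ->
    fot_sat (team_upd X 2 e) (mem_team u) <-> codes X a.
  move=> ua; rewrite -(codes_upd X 1 e); apply: mem_team_sat; first exact: team_upd_neq0.
  by move=> _ c [t Xt <-]; apply: ua; rewrite !fnd_upd.
have zE e b : fot_sat (team_upd X 2 e) (mem_team (tag b (Var 2))) <-> codes X (ktag b e).
  by apply: memE => t te; apply: eval_tag.
have kE e b : fot_sat (team_upd X 2 e) (mem_team (tag b (key d (Var 2))))
    <-> codes X (ktag b (kkey d e)).
  by apply: memE => t te; apply/eval_tag/eval_key.
have wE e b : fot_sat (team_upd X 2 e) (mem_team (tag b (iter d.+1 (tag true) (Var 2))))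
    <-> codes X (ktag b (iter d.+1 (ktag true) e)).
  by apply: memE => t te; apply/eval_tag/eval_tags.
split=> [sat e|G e].
- case: (sat e) => z [k [w0 w1]]; split.
  + by case: z => /zE; [exists false | exists true].
  + case: k => [/team_upd_neq0 //|k [k0 k1]].
    by apply: k; split; apply/kE.
  + by case; apply/wE.
- case: (G e) => [[b zb] nk w]; split.
    by case: b zb => /zE; [right | left].
  split; last by split; apply/wE.
  by right=> -[/kE k0 /kE k1]; apply: nk.
Qed.

End Coding.

(** * Correctness over an interpretation of [M] in [K] *)

Section Interpretation.
Variables (M K : structure) (h : K -> M) (sg : M -> K).
Hypothesis funI2 : forall a : K, funI 2 [:: a] = sg (h a).
Hypothesis sg_inj : injective sg.
Hypothesis h_surj : forall m, exists a, h a = m.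
Hypothesis funIE : forall i (v : seq M), funI i v = h (funI i.+3 (map sg v)).
Hypothesis relIE : forall i (v : seq M), relI i v <-> relI i (map sg v).
Hypothesis kpair_inj : forall a b c d : K, kpair a b = kpair c d -> a = c /\ b = d.
Hypothesis kcst_neq : @kcst K false <> @kcst K true.
Implicit Types (X Y : set (assignment K)) (t : assignment K) (s : assignment M).
Implicit Types (r : rel_assignment M) (a e : K).

Definition compat (V : seq var) t s :=
  {in V, forall x, s.[? x] /\ omap h t.[? x.+2] = s.[? x]}.

Lemma eval_tr V t s u : compat V t s -> {subset term_vars u <= V} ->
  exists2 m, eval s u = Some m & eval t (tr u) = Some (sg m).
Proof.
move=> ts; elim/term_ind': u => [x|i us IH] sub.
  have /= [] := ts x (sub _ (mem_head _ _)).
  case: (s.[? x]) => [m|] // _; case: (t.[? x.+2]) => [a|] //= [<-].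
  by exists (h a); rewrite //= funI2.
suff [v sv tv] : exists2 v, evals s us = Some v & evals t (map tr us) = Some (map sg v).
  exists (funI i v); first by rewrite /= -[oseq _]/(evals s us) sv.
  by rewrite /= -[oseq (map _ (map _ _))]/(evals t (map tr us)) tv /= funI2 funIE.
elim: us IH sub => [|u us IHus] /= => [_ _|[IHu IHs] sub]; first by exists [::].
have [x xu|m su tu] := IHu; first by apply: sub; rewrite /= mem_cat xu.
have [//|x xus|v sv tv] := IHus; first by apply: sub; rewrite /= mem_cat xus orbT.
by exists (m :: v); rewrite evals_cons ?su ?tu /= ?sv ?tv.
Qed.

Lemma evals_tr V t s us : compat V t s -> {subset terms_vars us <= V} ->
  exists2 v, evals s us = Some v & evals t (map tr us) = Some (map sg v).
Proof.
move=> ts; elim: us => [|u us IH] sub; first by exists [::].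
have [|m su tu] := @eval_tr V t s u ts.
  by move=> x xu; apply: sub; rewrite /terms_vars /= mem_cat xu.
have [|v sv tv] := IH.
  by move=> x xus; apply: sub; rewrite /terms_vars /= mem_cat xus orbT.
by exists (m :: v); rewrite evals_cons ?su ?tu /= ?sv ?tv.
Qed.

Lemma tr_atom_sat V t s l : compat V t s -> {subset atom_vars l <= V} ->
  atom_sat t (tr_atom l) <-> atom_sat s l.
Proof.
move=> ts; case: l => [u v|i us] /= sub.
- have [x xu|m su tu] := @eval_tr V t s u ts; first by apply: sub; rewrite mem_cat xu.
  have [x xv|m' sv tv] := @eval_tr V t s v ts; first by apply: sub; rewrite mem_cat xv orbT.
  rewrite su tu sv tv; split=> -[a [<-] []]; first by move/sg_inj->; exists m.
  by move->; exists (sg m).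
- have [v sv tv] := @evals_tr V t s us ts sub; rewrite sv tv.
  by split=> -[w [<-]] /relIE; [exists v|exists (map sg v)].
Qed.

Lemma ktag_inj b c a e : ktag b a = ktag c e -> b = c /\ a = e.
Proof.
by move/kpair_inj => [bc ->]; split=> //; move: bc; case: b; case: c => // /esym.
Qed.

Lemma kkey_inj d a e : kkey d a = kkey d e -> a = e.
Proof. by elim: d => [|d IH]; rewrite /kkey ?iterS => /ktag_inj[]. Qed.

(** Deeper keys are never keys of level [d], so fixing a relation at level [d] leaves their bits
    alone. *)
Lemma iter_ktag_neq d a e : iter d.+1 (ktag true) a <> kkey d e.
Proof.
elim: d => [|d IH]; first by move/ktag_inj=> [].
by rewrite iterS /kkey iterS => /ktag_inj[_ /IH].
Qed.

(** Equal lengths suffice: a level belongs to one relation variable, which fixes the arity. *)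
Lemma ktuple_inj v w : size v = size w -> ktuple (map sg v) = ktuple (map sg w) -> v = w.
Proof.
elim: v w => [|m v IH] [|m' w] //= [svw] /kpair_inj [/sg_inj -> /(IH _ svw) ->] //.
Qed.

(* The team stores, for every key [e], the two bits [ktag false e] and
   [ktag true e] or only one of them.  Both are present for the keys beyond the
   level [d], and exactly one, giving the truth value of [r i v], for the key
   of [v] at the level [env i n].  As at least one bit survives in a good
   subteam, the latter keys keep their bits. *)
Record coded d env (V : seq var) (W : seq (nat * nat)) X s r : Prop := Coded {
  coded_neq0 : X <> set0;
  coded_vars : forall t, X t -> compat V t s;
  coded_total : forall e, exists b, codes X (ktag b e);
  coded_free : forall b e, codes X (ktag b (iter d (ktag true) e));
  coded_rel : forall i n v, (i, n) \in W -> size v = n -> forall b : bool,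
    codes X (ktag b (kkey (env i n) (ktuple (map sg v)))) <-> (b <-> r i v) }.

Lemma sub_coded V V' W W' d env X s r : {subset V' <= V} -> {subset W' <= W} ->
  coded d env V W X s r -> coded d env V' W' X s r.
Proof.
move=> sV sW [X0 Xv Xt Xf Xr]; split=> // [t Xt' x /sV|i n v /sW]; last exact: Xr.
exact: Xv.
Qed.

Lemma codes_sub Y X a : Y `<=` X -> codes Y a -> codes X a.
Proof. by move=> YX [t /YX Xt ta]; exists t. Qed.

Lemma coded_sub d env V W X Y s r i n P : Y `<=` X -> Y <> set0 -> is_good d Y ->
  (forall v, size v = n -> codes Y (ktag true (kkey d (ktuple (map sg v)))) <-> P v) ->
  coded d env V [seq w <- W | w != (i, n)] X s r ->
  coded d.+1 (upd env i n d) V W Y s (rel_upd r i n P).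
Proof.
move=> YX Y0 G PE [X0 Xv Xt Xf Xr]; split=> //.
- by move=> t /YX; apply: Xv.
- by move=> e; case: (G e).
- by move=> b e; case: (G e).
move=> j m v jmW szv b; rewrite /upd /rel_upd xpair_eqE szv.
case: ifP => [/andP[/eqP ji /eqP mn]|jmin].
- have szn : size v = n by rewrite szv.
  have [_ nboth _] := G (ktuple (map sg v)).
  have [[c ck] _ _] := G (kkey d (ktuple (map sg v))).
  rewrite -(PE v szn); case: b; first by split=> [|[/(_ isT)]].
  split=> [cf|[_ nt]]; first by split=> // ct; case: nboth.
  by case: c ck => // /nt.
- have Wjm : (j, m) \in [seq w <- W | w != (i, n)].
    by rewrite mem_filter jmW xpair_eqE jmin.
  split=> [/(codes_sub YX)/(Xr _ _ _ Wjm szv)//|br].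
  (* At an older key some bit [c] survives in [Y], while [X] had only the bit giving the truth value
     of [r j v]. *)
  have [[c ck] _ _] := G (kkey (env j m) (ktuple (map sg v))).
  have := codes_sub YX ck; rewrite (Xr _ _ _ Wjm szv) => cr.
  suff <- : c = b by [].
  by apply/idP/idP => [/cr/br|/br/cr].
Qed.

(** Every relation is chosen by some good subteam: from [X], only the bits of level [d] that
    contradict [P] are removed. *)
Lemma coded_exists d env V W X s r (n : nat) (P : seq M -> Prop) :
  coded d env V W X s r ->
  exists Y, [/\ Y `<=` X, Y <> set0, is_good d Y &
    forall v, size v = n -> codes Y (ktag true (kkey d (ktuple (map sg v)))) <-> P v].
Proof.
move=> [X0 Xv Xt Xf Xr].
(* One bit has to remain at each key of level [d], so keys that carry no tuple of length [n] get the
   value false. *)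
pose Q e := `[< exists2 v, e = ktuple (map sg v) & size v = n /\ P v >].
pose Y := [set t | X t /\ forall b e, t.[? 0] = Some (ktag b (kkey d e)) -> b = Q e].
have codesY a : codes Y a <-> codes X a /\ forall b e, a = ktag b (kkey d e) -> b = Q e.
  split=> [[t [Xt' tQ] ta]|[[t Xt' ta] aQ]]; first last.
    by exists t => //; split=> // b e; rewrite ta => -[/aQ].
  by split=> [|b e ae]; [exists t | apply: tQ; rewrite ta ae].
have YX : Y `<=` X by move=> t [].
have freeY b e : codes X (ktag b (kkey d e)).
  by have := Xf b (ktag false e).
have totalY e : exists b, codes Y (ktag b e).
  case: (pselect (exists a, e = kkey d a)) => [[a ->]|nk].
    exists (Q a); apply/codesY; split; first exact: freeY.
    by move=> b a' /ktag_inj[<- /kkey_inj <-].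
  have [b eb] := Xt e; exists b; apply/codesY; split=> // c a /ktag_inj[_ ea].
  by case: nk; exists a.
exists Y; split=> //.
- by move=> Y0; have [b [t]] := totalY (kcst K false); rewrite Y0.
- move=> e; split=> //.
    move=> [/codesY[_ /(_ _ _ erefl) Qf] /codesY[_ /(_ _ _ erefl) Qt]].
    by move: Qf; rewrite -Qt.
  move=> b; apply/codesY; split; first by rewrite iterSr; apply: Xf.
  by move=> c a /ktag_inj[_ /iter_ktag_neq].
move=> v szv; rewrite codesY; split=> [[_ /(_ _ _ erefl)/esym/asboolP[w]]|Pv].
  by move=> /ktuple_inj vw [szw]; rewrite vw // szv szw.
split=> // b e /ktag_inj[<- /kkey_inj <-]; apply/esym/asboolP.
by exists v.
Qed.

Lemma coded_upd d env V W X s r x a : coded d env [seq y <- V | y != x] W X s r ->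
  coded d env V W (team_upd X x.+2 a) s.[x <- h a] r.
Proof.
move=> [X0 Xv Xt Xf Xr]; split.
- exact: team_upd_neq0.
- move=> _ [t Xt' <-] y yV; rewrite !fnd_upd !eqSS; case: ifP => [//|/negbT yx].
  by apply: Xv => //; rewrite mem_filter yx.
- by move=> e; have [b Xb] := Xt e; exists b; apply/codes_upd.
- by move=> b e; apply/codes_upd.
- by move=> i n v ? ? b; rewrite codes_upd; apply: Xr.
Qed.

(** The implication for [SAll2] also ranges over the empty subteam, where [good] holds but nothing
    is coded. *)
Lemma fot_sat_set0 phi : fot_sat (set0 : set (assignment K)) phi.
Proof.
have upd0 x a : team_upd (set0 : set (assignment K)) x a = set0.
  by apply/seteqP; split=> // t [].
elim: phi => //=.
- by left.
- by left.
- by move=> x phi IH; have [a] := dom_nonempty K; exists a; rewrite upd0.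
- by move=> x phi IH a; rewrite upd0.
- by move=> phi IH psi IH' Y Y0 _; suff -> : Y = set0 by []; apply/seteqP; split.
Qed.

Lemma fot_of_sat phi d env X s r : coded d env (so_fv phi) (so_frv phi) X s r ->
  fot_sat X (fot_of phi d env) <-> so_sat s r phi.
Proof.
elim: phi d env X s r => [l|i us|phi IH|phi IH psi IH'|phi IH psi IH'|x phi IH|x phi IH
  |i n phi IH|i n phi IH] d env X s r cX; have X0 := coded_neq0 cX.
- have trE t : X t -> atom_sat t (tr_atom l) <-> atom_sat s l.
    by move=> Xt; apply: tr_atom_sat (coded_vars cX Xt) _.
  split=> [sat|sat t /trE[_]]; last exact.
  by have [t Xt] := neq0_mem X0; apply/(trE t Xt)/sat.
(* The tuple is determined by [s], so it can be read off any one member of the team. *)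
- have [t0 Xt0] := neq0_mem X0.
  have [v sv tv0] := evals_tr (coded_vars cX Xt0) (fun x => id).
  pose e := ktag true (kkey (env i (size us)) (ktuple (map sg v))).
  rewrite [fot_of _ _ _]/= [so_sat _ _ _]/= (@mem_team_sat _ _ _ e) //.
    rewrite (coded_rel cX (mem_head _ _) (size_evals sv)) sv.
    split=> [[/(_ isT) rv _]|[w [<-] rv]]; [by exists v|by []].
  move=> t a Xt; apply/eval_tag/eval_key/eval_tuple.
  have ts : compat (so_fv (SRel i us)) t.[1 <- a] s.
    by move=> x xV; have := coded_vars cX Xt xV; rewrite fnd_upd.
  have [w sw tw] := evals_tr ts (fun x => id).
  by move: sw tw; rewrite sv => -[<-].
- by rewrite [fot_sat _ _]/= (IH _ _ _ _ _ cX); split=> [[]|]; last right.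
- have c1 : coded d env (so_fv phi) (so_frv phi) X s r.
    by apply: sub_coded cX => x xV; rewrite mem_cat xV.
  have c2 : coded d env (so_fv psi) (so_frv psi) X s r.
    by apply: sub_coded cX => x xV; rewrite mem_cat xV orbT.
  by rewrite [fot_sat _ _]/= (IH _ _ _ _ _ c1) (IH' _ _ _ _ _ c2).
- have c1 : coded d env (so_fv phi) (so_frv phi) X s r.
    by apply: sub_coded cX => x xV; rewrite mem_cat xV.
  have c2 : coded d env (so_fv psi) (so_frv psi) X s r.
    by apply: sub_coded cX => x xV; rewrite mem_cat xV orbT.
  by rewrite [fot_sat _ _]/= (IH _ _ _ _ _ c1) (IH' _ _ _ _ _ c2).
- have cU a := coded_upd a cX.
  split=> [[a /(IH _ _ _ _ _ (cU a)) sat]|[m sat]]; first by exists (h a).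
  have [a am] := h_surj m; exists a; apply/(IH _ _ _ _ _ (cU a)).
  by rewrite am.
- have cU a := coded_upd a cX.
  split=> [sat m|sat a]; last by apply/(IH _ _ _ _ _ (cU a)).
  by have [a <-] := h_surj m; apply/(IH _ _ _ _ _ (cU a)).
- split=> [[//|/existsNP[Y /not_implyP[YX /not_implyP[goodY]]]]|[P sat]].
    (* The inner [FNot] fails at [Y], which is therefore nonempty. *)
    move=> /not_orP[Y0 /contrapT satY].
    have /good_sat G := goodY.
    have cY := coded_sub YX Y0 (G Y0) (fun v _ => iff_refl _) cX.
    by eexists; apply/(IH _ _ _ _ _ cY).
  have [Y [YX Y0 G PE]] := coded_exists n P cX.
  have cY := coded_sub YX Y0 G PE cX.
  right=> /(_ Y YX); case; [exact/good_sat|by []|].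
  by apply; apply/(IH _ _ _ _ _ cY).
- split=> [sat P|sat Y YX goodY].
    have [Y [YX Y0 G PE]] := coded_exists n P cX.
    have cY := coded_sub YX Y0 G PE cX.
    by apply/(IH _ _ _ _ _ cY)/sat => //; apply/good_sat.
  case: (pselect (Y = set0)) => [->|Y0]; first exact: fot_sat_set0.
  have /good_sat G := goodY.
  have cY := coded_sub YX Y0 (G Y0) (fun v _ => iff_refl _) cX.
  by apply/(IH _ _ _ _ _ cY)/sat.
Qed.

End Interpretation.

(** * The axioms and the two structures *)

Lemma axioms_sat (K : structure) (X : set (assignment K)) : X <> set0 ->
  fot_sat X axioms <->
  [/\ kcst K false <> kcst K true,
      forall a b : K, funI 0 [:: kpair a b] = a /\ funI 1 [:: kpair a b] = b &
      forall e, codes X e].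
Proof.
move=> X0; have [t0 Xt0] := neq0_mem X0; split.
- case=> [[//|neq]] [ax full]; split.
  + move=> eq; apply: neq => t _; exists (kcst K false) => //.
    by rewrite /= -[funI _ _]/(kcst K true) -eq.
  + move=> a b; have [] := ax a b.
    have Xab : team_upd (team_upd X 1 a) 2 b t0.[1 <- a].[2 <- b].
      by exists t0.[1 <- a] => //; exists t0.
    move=> /(_ _ Xab) [c /=]; rewrite !fnd_upd /= => -[<-] [<-].
    by move=> /(_ _ Xab) [c' /=]; rewrite !fnd_upd /= => -[<-] [<-].
  + move=> e; have [/team_upd_neq0 //|] := full e.
    move/existsNP => [_ /not_implyP [[t Xt <-]]] /contrapT [].
    by rewrite !fnd_upd /= => te; exists t.
- case=> neq ax full; split; [right|split].
  + by move=> /(_ _ Xt0) [c [<-] [] eq]; apply: neq.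
  + move=> a b; have [ax0 ax1] := ax a b.
    split=> _ [_ [t Xt <-] <-]; [exists a|exists b]; rewrite /= !fnd_upd //=.
    * by congr Some.
    * by congr Some.
  + move=> e; right=> /(_ _ _); have [t Xt te] := full e.
    move=> /(_ t.[1 <- e]); apply; first by exists t.
    by rewrite /= !fnd_upd te.
Qed.

Lemma closed_coded M K h sg (X : set (assignment K)) (s : assignment M) r phi :
  closed_so phi -> X <> set0 -> (forall e, codes X e) ->
  coded h sg 0 (fun _ _ => 0) (so_fv phi) (so_frv phi) X s r.
Proof.
case/andP=> /nilP -> /nilP -> X0 full; split=> //; by move=> e; exists true.
Qed.

Lemma kpair_projI (K : structure) :
  (forall a b : K, funI 0 [:: kpair a b] = a /\ funI 1 [:: kpair a b] = b) ->
  forall a b c d : K, kpair a b = kpair c d -> a = c /\ b = d.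
Proof.
move=> ax a b c d abcd; have [a1 b1] := ax a b; have [c1 d1] := ax c d.
by split; [rewrite -a1 abcd | rewrite -b1 abcd].
Qed.

Section Range.
Variable K : structure.

Definition range_dom := {x : K | exists a, x = funI 2 [:: a]}.

Definition to_range (a : K) : range_dom := exist _ (funI 2 [:: a]) (ex_intro _ a erefl).

Lemma range_nonempty : inhabited range_dom.
Proof. by have [a] := dom_nonempty K; exists; apply: to_range. Qed.

Definition range_structure : structure := Structure range_nonempty
  (fun i v => to_range (funI i.+3 (map sval v))) (fun i v => relI i (map sval v)).

End Range.

(** The free pairing structure over [A], in which a finite structure also embeds, as leaves. *)
Inductive tree (A : Type) := Leaf (a : A) | Node (t u : tree A).

Section TreeStructure.
Variables (M : structure) (m0 : M).

Definition leaf_of (t : tree M) : M := if t is Leaf m then m else m0.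

Definition tree_fun (i : nat) (v : seq (tree M)) : tree M :=
  match i, v with
  | 0, [::] => Leaf m0
  | 1, [::] => Node (Leaf m0) (Leaf m0)
  | 0, [:: a] => if a is Node b _ then b else a
  | 1, [:: a] => if a is Node _ b then b else a
  | 0, [:: a; b] => Node a b
  | 2, [:: a] => Leaf (leaf_of a)
  | i.+3, _ => Leaf (funI i (map leaf_of v))
  | _, _ => Leaf m0
  end.

Definition tree_structure : structure := Structure (inhabits (Leaf m0))
  tree_fun (fun i v => relI i (map leaf_of v)).

End TreeStructure.

Lemma fot_of_so_valid (Phi : so_sentence) :
  fot_valid (fot_of_so (val Phi)) <-> so_valid Phi.
Proof.
case: Phi => phi closed; split=> valid /=.
- move=> M s r; have [m0] := dom_nonempty M; pose K := tree_structure m0.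
  pose D := [fset x | x in 0 :: fot_fv (fot_of_so phi)]%fset.
  (* The team of all assignments on [D] is full at the variable 0. *)
  pose X := [set t : assignment K | domf t = D].
  have DV x : x \in 0 :: fot_fv (fot_of_so phi) -> x \in D by rewrite !inE.
  have full e : codes X e.
    have D0 : 0 \in D by rewrite !inE.
    by exists [fmap x : D => e] => //; rewrite (in_fnd (f := [fmap x : D => e]) D0) ffunE.
  have X0 : X <> set0 by move=> X0; have [t] := full (Leaf m0); rewrite X0.
  have ax (a b : K) : funI 0 [:: kpair a b] = a /\ funI 1 [:: kpair a b] = b by [].
  have c01 : kcst K false <> kcst K true by [].
  have leafK : map (@leaf_of M m0) \o map (@Leaf M) =1 id.
    by move=> v; rewrite /= -map_comp map_id.
  apply/(@fot_of_sat M K (@leaf_of M m0) (@Leaf M) _ _ _ _ _ _ _ _ _ _ X); last first.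
    + case: (valid K D X) => [x xV|t //|[//|nax]|sat]; last exact: sat.
        by apply: DV; rewrite in_cons xV orbT.
      by case: nax; apply/axioms_sat.
    + exact: closed_coded.
    + by [].
    + exact: kpair_projI.
    + by move=> i v; rewrite /= -[map _ _]/((map (@leaf_of M m0) \o map (@Leaf M)) v) leafK.
    + by move=> i v; rewrite /= -[map _ _]/((map (@leaf_of M m0) \o map (@Leaf M)) v) leafK.
    + by move=> m; exists (Leaf m).
    + by move=> a b [].
    + by [].
- move=> K D X VD XD.
  have [->|X0] := pselect (X = set0); first by left; left.
  have [/(axioms_sat X0)[c01 ax full]|nax] := pselect (fot_sat X axioms).
  2: by left; right.
  (* Here [to_range] is the surjection and [sval] the embedding. *)
  right; pose M := range_structure K.
  have coM := @closed_coded M K (@to_range K) sval X [fmap] (fun _ _ => True)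
    phi closed X0 full.
  apply/(fot_of_sat _ _ _ _ _ _ _ coM); last exact: valid.
  + by [].
  + by move=> [x px] [y py] /= xy; apply: eq_exist.
  + by move=> [x [a xa]]; exists a; apply: eq_exist.
  + by [].
  + by [].
  + exact: kpair_projI.
  + by [].
Qed.

(** * Realizers of numerical and list functions *)

Lemma code_nats_closed s : lclosed (code_seq code_nat s).
Proof. exact/code_seq_closed/foldr_and/code_nat_closed. Qed.

Definition natsR := base [::] code_nats_closed.

#[local] Instance realizable_foldr_nat T (B : rty T) :
  realizable (arr (arr natR (arr B B)) (arr B (arr natsR B))) foldr.
Proof. exact: realizable_foldr. Qed.
#[local] Instance realizable_foldr_term T (B : rty T) :
  realizable (arr (arr termR (arr B B)) (arr B (arr termsR B))) foldr.
Proof. exact: realizable_foldr. Qed.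
#[local] Instance realizable_foldr_pair T (B : rty T) :
  realizable (arr (arr pairR (arr B B)) (arr B (arr pairsR B))) foldr.
Proof. exact: realizable_foldr. Qed.
#[local] Instance realizable_term_fold_nat :
  realizable (arr (arr natR natR) (arr (arr natR (arr natsR natR)) (arr termR natR)))
    (@term_fold nat).
Proof. exact: realizable_term_fold. Qed.
#[local] Instance realizable_term_fold_term :
  realizable (arr (arr natR termR) (arr (arr natR (arr termsR termR)) (arr termR termR)))
    (@term_fold term).
Proof. exact: realizable_term_fold. Qed.

(** Realizability depends only on the function, so its definition may first be rewritten, by
    functional extensionality, into combinators known to [denote]. *)
Lemma realizable_eq T (A : rty T) f g : realizable A f -> f = g -> realizable A g.
Proof. by move=> rf <-. Qed.

#[local] Instance realizable_fst : realizable (arr pairR natR) fst.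
Proof.
apply: (@realizable_eq _ _ (fun p => pair_case (fun n m => n) p)); first realize.
by apply: funext => -[].
Qed.

#[local] Instance realizable_snd : realizable (arr pairR natR) snd.
Proof.
apply: (@realizable_eq _ _ (fun p => pair_case (fun n m => m) p)); first realize.
by apply: funext => -[].
Qed.

#[local] Instance realizable_addn : realizable (arr natR (arr natR natR)) addn.
Proof.
apply: (@realizable_eq _ _ (fun n m => natrec m (fun _ => S) n)); first realize.
by apply: funext => n; apply: funext => m; elim: n => //= n ->.
Qed.

#[local] Instance realizable_iter :
  realizable (arr natR (arr (arr termR termR) (arr termR termR))) (@iter term).
Proof.
apply: (@realizable_eq _ _ (fun n f x => natrec x (fun _ => f) n)); first realize.
by apply: funext => n; apply: funext => f; apply: funext => x; elim: n => //= n ->.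
Qed.

#[local] Instance realizable_map :
  realizable (arr (arr termR termR) (arr termsR termsR)) map.
Proof.
apply: (@realizable_eq _ _ (fun f s => foldr (fun t us => f t :: us) [::] s)).
  by realize.
by apply: funext => f; apply: funext; elim=> //= t s ->.
Qed.

#[local] Instance realizable_size : realizable (arr termsR natR) size.
Proof.
apply: (@realizable_eq _ _ (fun s => foldr (fun _ => S) 0 s)); first realize.
by apply: funext; elim=> //= t s ->.
Qed.

(** Equality test and branching in one, which avoids realizers for Booleans. *)
Definition ifeq (i j x y : nat) := if i == j then x else y.

#[local] Instance realizable_ifeq :
  realizable (arr natR (arr natR (arr natR (arr natR natR)))) ifeq.
Proof.
(* The recursion on [i] runs at a function type, so that [j] can decrease along with it. *)
apply: (@realizable_eq _ _ (fun i => natrec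
  (fun j x y => natrec x (fun _ _ => y) j)
  (fun _ rec j x y => natrec y (fun j' _ => rec j' x y) j) i)); first realize.
apply: funext; elim=> [|i IH]; apply: funext => -[|j] //.
by apply: funext => x; apply: funext => y; rewrite /= IH.
Qed.

(** * The translations are computable *)

#[local] Instance realizable_down : realizable (arr natR termsR) down.
Proof.
apply: (@realizable_eq _ _ (fun n => natrec [::] (fun n ts => Var n :: ts) n)).
  by realize.
by apply: funext; elim=> //= n ->.
Qed.

#[local] Instance realizable_alls : realizable (arr natR (arr soR soR)) alls.
Proof.
apply: (@realizable_eq _ _ (fun n phi => natrec phi (fun n => SAll n) n)).
  by realize.
by apply: funext => n; apply: funext => phi; elim: n => //= n ->.
Qed.

#[local] Instance realizable_simp : realizable (arr soR (arr soR soR)) simp.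
Proof.
apply: (@realizable_eq _ _ (fun phi psi => SNot (SAnd phi (SNot psi)))) => //.
by realize.
Qed.

#[local] Instance realizable_siff : realizable (arr soR (arr soR soR)) siff.
Proof.
apply: (@realizable_eq _ _ (fun phi psi => SAnd (simp phi psi) (simp psi phi))) => //.
by realize.
Qed.

#[local] Instance realizable_row : realizable (arr natR (arr natR soR)) row.
Proof. by apply: (@realizable_eq _ _ (fun N i => SRel i (down N))) => //; realize. Qed.

#[local] Instance realizable_reset : realizable (arr natR (arr natR (arr natR soR))) reset.
Proof.
apply: (@realizable_eq _ _ (fun N x i =>
  alls N (siff (row N (S i)) (SAnd (SAtom (Eq (Var x) (Var N))) (SEx x (row N i)))))) => //.
by realize.
Qed.

#[local] Instance realizable_eqs : realizable (arr pairsR (arr soR soR)) eqs.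
Proof.
apply: (@realizable_eq _ _ (fun xys phi =>
  foldr (fun p => SAnd (SAtom (Eq (Var (fst p)) (Var (snd p))))) phi xys)) => //.
by realize.
Qed.

(** The team index changes in recursive calls, so the fold runs at the type of functions of the
    index. *)
#[local] Instance realizable_so_of : realizable (arr natR (arr fotR (arr natR soR))) so_of.
Proof.
apply: (@realizable_eq _ _ (fun N phi => fot_fold
  (fun l i => alls N (simp (row N i) (SAtom l)))
  (fun xys i => alls N (SNot (eqs xys (row N i))))
  (fun f i => SOr (alls N (SNot (row N i))) (SNot (f i)))
  (fun f g i => SAnd (f i) (g i))
  (fun f g i => SOr (f i) (g i))
  (fun x f i => SEx N (SEx2 (S i) N (SAnd (reset N x i) (f (S i)))))
  (fun x f i => SAll N (SEx2 (S i) N (SAnd (reset N x i) (f (S i)))))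
  (fun f g i => SAll2 (S i) N
      (simp (SAnd (alls N (simp (row N (S i)) (row N i))) (f (S i))) (g (S i))))
  phi)).
  by realize.
apply: funext => N; apply: funext; elim=> //= *; apply: funext => i;
  by repeat match goal with H : _ = _ |- _ => rewrite H end.
Qed.

#[local] Instance realizable_term_bound : realizable (arr termR natR) term_bound.
Proof.
apply: (@realizable_eq _ _
  (fun t => term_fold (fun x => S x) (fun _ ns => foldr addn 0 ns) t)) => //.
by realize.
Qed.

#[local] Instance realizable_atom_bound : realizable (arr atomR natR) atom_bound.
Proof.
apply: (@realizable_eq _ _ (fun l => atom_case (fun t u => term_bound t + term_bound u)
  (fun _ ts => foldr (fun t => addn (term_bound t)) 0 ts) l)) => //.
by realize.
Qed.

#[local] Instance realizable_fot_bound : realizable (arr fotR natR) fot_bound.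
Proof.
apply: (@realizable_eq _ _ (fun phi => fot_fold (fun l => atom_bound l)
  (fun xys => foldr (fun p => addn (S (fst p) + S (snd p))) 0 xys)
  (fun n => n) addn addn (fun x => addn (S x)) (fun x => addn (S x)) addn phi)) => //.
by realize.
Qed.

#[local] Instance realizable_so_of_fot : realizable (arr fotR soR) so_of_fot.
Proof.
apply: (@realizable_eq _ _ (fun phi =>
  SAll2 0 (fot_bound phi) (so_of (fot_bound phi) phi 0))) => //.
by realize.
Qed.

#[local] Instance realizable_neq01 : realizable fotR (FNeq [:: (0, 1)]) :=
  realizable_base _ _ _.

#[local] Instance realizable_pair_term : realizable (arr termR (arr termR termR)) pair_term.
Proof. by apply: (@realizable_eq _ _ (fun t u => Fun 0 [:: t; u])) => //; realize. Qed.

#[local] Instance realizable_cst b : realizable termR (cst b) := realizable_base _ _ _.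

#[local] Instance realizable_tag b : realizable (arr termR termR) (tag b).
Proof. by apply: (@realizable_eq _ _ (fun t => pair_term (cst b) t)) => //; realize. Qed.

#[local] Instance realizable_key : realizable (arr natR (arr termR termR)) key.
Proof.
apply: (@realizable_eq _ _ (fun d t => iter d (tag true) (tag false t))) => //.
by realize.
Qed.

#[local] Instance realizable_tuple_term : realizable (arr termsR termR) tuple_term.
Proof.
apply: (@realizable_eq _ _ (fun ts => foldr pair_term (cst false) ts)) => //.
by realize.
Qed.

#[local] Instance realizable_tr : realizable (arr termR termR) tr.
Proof.
apply: (@realizable_eq _ _ (fun t => term_fold (fun x => Fun 2 [:: Var (S (S x))])
   (fun i ts => Fun 2 [:: Fun (S (S (S i))) ts]) t)) => //.
by realize.
Qed.

#[local] Instance realizable_tr_atom : realizable (arr atomR atomR) tr_atom.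
Proof.
apply: (@realizable_eq _ _ (fun l => atom_case (fun t u => Eq (tr t) (tr u))
  (fun i ts => Rel i (map tr ts)) l)) => //.
by realize.
Qed.

#[local] Instance realizable_mem_team : realizable (arr termR fotR) mem_team.
Proof.
apply: (@realizable_eq _ _ (fun u =>
  FEx 1 (FAnd (FAtom (Eq (Var 1) u)) (FNot (FNeq [:: (0, 1)]))))) => //.
by realize.
Qed.

#[local] Instance realizable_good : realizable (arr natR fotR) good.
Proof.
apply: (@realizable_eq _ _ (fun d =>
  FAll 2 (FAnd (FOr (mem_team (tag false (Var 2))) (mem_team (tag true (Var 2))))
    (FAnd (FNot (FAnd (mem_team (tag false (key d (Var 2))))
                      (mem_team (tag true (key d (Var 2))))))
          (FAnd (mem_team (tag false (iter (S d) (tag true) (Var 2))))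
                (mem_team (tag true (iter (S d) (tag true) (Var 2))))))))) => //.
by realize.
Qed.

#[local] Instance realizable_upd :
  realizable (arr (arr natR (arr natR natR))
    (arr natR (arr natR (arr natR (arr natR (arr natR natR)))))) upd.
Proof.
apply: (@realizable_eq _ _ (fun e i n d j m => ifeq j i (ifeq m n d (e j m)) (e j m))).
  by realize.
apply: funext => e; apply: funext => i; apply: funext => n; apply: funext => d.
by apply: funext => j; apply: funext => m; rewrite /ifeq /upd; do 2!case: eqP.
Qed.

(** The environment is passed as a realizer of a function, not as coded data. *)
#[local] Instance realizable_fot_of :
  realizable (arr soR (arr natR (arr (arr natR (arr natR natR)) fotR))) fot_of.
Proof.
apply: (@realizable_eq _ _ (fun phi => so_fold
  (fun l d e => FAtom (tr_atom l))
  (fun i ts d e => mem_team (tag true (key (e i (size ts)) (tuple_term (map tr ts)))))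
  (fun f d e => FNot (f d e))
  (fun f g d e => FAnd (f d e) (g d e))
  (fun f g d e => FOr (f d e) (g d e))
  (fun x f d e => FEx (S (S x)) (f d e))
  (fun x f d e => FAll (S (S x)) (f d e))
  (fun i n f d e => FNot (FImp (good d) (FNot (f (S d) (upd e i n d)))))
  (fun i n f d e => FImp (good d) (f (S d) (upd e i n d))) phi)).
  by realize.
apply: funext; elim=> //= *; apply: funext => d; apply: funext => e;
  by repeat match goal with H : _ = _ |- _ => rewrite H end.
Qed.

#[local] Instance realizable_axioms : realizable fotR axioms := realizable_base _ _ _.

#[local] Instance realizable_fot_of_so : realizable (arr soR fotR) fot_of_so.
Proof.
apply: (@realizable_eq _ _
  (fun phi => FOr (FNot axioms) (fot_of phi 0 (fun _ _ => 0)))) => //.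
by realize.
Qed.

Lemma realizable_computable A B codeA codeB (a0 : A) (b0 : B) cA cB f :
  realizable (arr (@base _ codeA a0 cA) (@base _ codeB b0 cB)) f ->
  computable codeA codeB f.
Proof.
case=> p [cp pf]; exists p => // a.
by have [] := pf _ _ (code_realizes a0 cA a).
Qed.

Theorem corollary4p5 :
  (exists f : fot -> so_sentence,
     computable code_fot code_sentence f /\
     forall phi : fot, so_valid (f phi) <-> fot_valid phi) /\
  (exists g : so_sentence -> fot,
     computable code_sentence code_fot g /\
     forall Phi : so_sentence, fot_valid (g Phi) <-> so_valid Phi).
Proof.
split.
- exists sentence_of_fot; split; last exact: sentence_of_fot_valid.
  (* The code of a sentence is that of its underlying formula, so a realizer on formulas serves as
     it is. *)
  have [p cp pf] := realizable_computable realizable_so_of_fot.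
  by exists p.
- exists (fun Phi => fot_of_so (val Phi)); split; last exact: fot_of_so_valid.
  have [p cp pf] := realizable_computable realizable_fot_of_so.
  by exists p => // Phi; apply: pf.
Qed.
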